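(* Let $T>0$, $0<\alpha<1$, $0<\lambda<1$ and $\omega\in A_1^+$. Abel's equation $$I_{0^+}^{\alpha}\varphi(x)=f(x),\quad x>0,$$ (with given $f$ and unknown $\varphi$) is solvable in $L^{1,\lambda}_+((0,T),\omega)$ if and only if $$f_{1-\alpha}\in AC([0,T]),\quad f_{1-\alpha}(0)=0,\quad\text{and}\quad f'_{1-\alpha}\in L^{1,\lambda}_+((0,T),\omega),$$ where $f'_{1-\alpha}(x)=\frac{d}{dx}f_{1-\alpha}(x)$. When these conditions are satisfied, the equation has a unique solution, given by $$\varphi(x)=\frac{1}{\Gamma(1-\alpha)}\frac{d}{dx}\int_{0}^{x}\frac{f(t)\,dt}{(x-t)^{\alpha}}=D_{0^{+}}^{\alpha}f(x).$$
   Context: A weight $\omega$ is a positive function on $\mathbb{R}$. Functions are considered on $(0,T)$. Riemann-Liouville integral and derivative of order $\alpha\in(0,1)$: $I_{0^+}^{\alpha}g(x)=\frac{1}{\Gamma(\alpha)}\int_{0}^{x}\frac{g(t)}{(x-t)^{1-\alpha}}\,dt$ and $D_{0^+}^{\alpha}g(x)=\frac{d}{dx}I_{0^+}^{1-\alpha}g(x)$ for $0<x<T$. Denote $$f_{1-\alpha}(x)=I_{0^{+}}^{1-\alpha}f(x)=\frac{1}{\Gamma(1-\alpha)}\int_{0}^{x}\frac{f(t)\,dt}{(x-t)^{\alpha}}.$$ $AC([0,T])$ is the space of absolutely continuous functions on $[0,T]$. ''Solvable in $L^{1,\lambda}_+((0,T),\omega)$'' means there is a solution $\varphi$ in that space.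 Weight class: $\omega\in A_1^+$ means $M^-\omega\le C\omega$ for some constant $C$, where $M^-g(x)=\sup_{h>0}\frac1h\int_{x-h}^x|g(y)|\,dy$. Local one-sided weighted Morrey space: $L^{1,\lambda}_+((0,T),\omega)$ consists of the functions $g$ on $(0,T)$ with $$\|g\|_{L^{1,\lambda}_{+}((0,T),\omega)}=\sup_{0\leq x_0\leq T,\ 0<h\leq T}\frac{1}{h^{\lambda-1}\int_{x_0-h}^{x_0}\omega(x)\,dx}\int_{(x_0,x_0+h)\cap(0,T)}|g(y)|\,dy<\infty.$$ *)

(* Defs.v *)
From HB Require Import structures.
From mathcomp Require Export all_boot all_order all_algebra.
From mathcomp Require Export all_classical all_reals all_analysis.
Export Order.TTheory GRing.Theory Num.Theory.
Export numFieldNormedType.Exports.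

Set Implicit Arguments.
Unset Strict Implicit.
Unset Printing Implicit Defensive.

Local Open Scope classical_set_scope.
Local Open Scope ring_scope.

Section defs.
Context {R : realType}.
Local Notation mu := (@lebesgue_measure R).
Implicit Types (D : set R) (g f phi omega : R -> R) (a x T lambda : R).

(* [measurable_fun] on [R] is Borel measurability; a function is Lebesgue
   measurable on [D] iff it agrees almost everywhere on [D] with a Borel one.
   The library integral is a difference of suprema of integrals of simple
   functions, so that on such functions [\int[mu]] has the value of the
   Lebesgue integral. *)
Definition lebesgue_measurable D g : Prop :=
  exists2 g0 : R -> R, measurable_fun D g0 &
    {ae mu, forall x, D x -> g x = g0 x}.

Definition lebesgue_integrable D g : Prop :=
  lebesgue_measurable D g /\ (\int[mu]_(x in D) `|(g x)%:E| < +oo)%E.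

Definition Gamma a : R :=
  \int[mu]_(t in `]0, +oo[) (t `^ (a - 1) * expR (- t)).

Definition RL_integrand a g x : R -> R := fun t => g t / (x - t) `^ (1 - a).

(* [RL_integral a g x] has its intended meaning only where
   [RL_defined a g x] holds: the library integral is total. *)
Definition RL_defined a g x : Prop :=
  lebesgue_integrable `]0, x[ (RL_integrand a g x).

Definition RL_integral a g x : R :=
  (Gamma a)^-1 * \int[mu]_(t in `]0, x[) RL_integrand a g x t.

Definition RL_derivative a g : R -> R := derive1 (RL_integral (1 - a) g).

Definition weight omega : Prop :=
  (forall x, 0 < omega x) /\ lebesgue_measurable [set: R] omega.

Definition maximal_minus g x : \bar R :=
  ereal_sup [set ((h^-1)%R%:E * \int[mu]_(y in `[(x - h)%R, x]) `|(g y)%:E|)%E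
            | h in [set h : R | 0 < h]].

Definition A1plus omega : Prop :=
  exists C : R, {ae mu, forall x, (maximal_minus omega x <= (C * omega x)%R%:E)%E}.

(* For omega positive and in [A1plus], the inverted factor is the inverse of
   a positive real. *)
Definition morrey_norm T lambda omega g : \bar R :=
  ereal_sup [set v | exists x0 h : R, [/\ 0 <= x0 <= T, 0 < h <= T &
    v = (((h `^ (lambda - 1))%R%:E * \int[mu]_(x in `[(x0 - h)%R, x0]) (omega x)%:E)^-1
         * \int[mu]_(y in `]x0, (x0 + h)%R[ `&` `]0%R, T[) `|(g y)%:E|)%E]].

Definition in_morrey T lambda omega g : Prop :=
  lebesgue_measurable `]0, T[ g /\ (morrey_norm T lambda omega g < +oo)%E.

Definition abs_continuous (b c : R) (F : R -> R) : Prop :=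
  forall e : R, 0 < e -> exists2 d : R, 0 < d &
    forall (n : nat) (u v : 'I_n -> R),
      (forall i, [/\ b <= u i, u i <= v i & v i <= c]) ->
      trivIset [set: 'I_n] (fun i => `]u i, v i[%classic) ->
      \sum_i (v i - u i) < d ->
      \sum_i `|F (v i) - F (u i)| < e.

(* I^a phi = f on (0, T), almost everywhere: for phi merely integrable,
   I^a phi x converges only for almost every x. *)
Definition abel_solution T a f phi : Prop :=
  {ae mu, forall x, 0 < x < T ->
    RL_defined a phi x /\ RL_integral a phi x = f x}.

Definition abel_solvable_morrey T lambda omega a f : Prop :=
  exists phi, in_morrey T lambda omega phi /\ abel_solution T a f phi.

(* The function f_{1-a} is given by a convergent integral on (0, T); F is its
   extension to [0, T]. The endpoint value is F 0, and not the integral over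
   the empty interval, which is 0 for every f. *)
Definition abel_condition T lambda omega a f : Prop :=
  (exists F : R -> R,
    [/\ forall x, 0 < x < T ->
          RL_defined (1 - a) f x /\ F x = RL_integral (1 - a) f x,
        abs_continuous 0 T F &
        F 0 = 0]) /\
  in_morrey T lambda omega (derive1 (RL_integral (1 - a) f)).

End defs.

(* Main.v *)
From HB Require Import structures.
Require Import Defs.
From mathcomp Require Import measurable_realfun ring lra.

(** Write [b = 1 - a]. The equation [I^a phi = f] is inverted by applying
    [I^b]: by Fubini, [I^b (I^a phi) x] is the integral of [phi s] against
    the convolution of the two kernels [t^(a-1)] and [t^(b-1)] from [s] to
    [x], and this Beta integral does not depend on the interval: it equals
    [Gamma a * Gamma b], which cancels the normalizing factors. Hence
    [I^b f x] is the integral of [phi] over (0, x) whenever [phi] solves the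
    equation (abel_inversion). Everything else follows from this identity.

    Necessity and uniqueness: a solution is integrable on (0, c) for each
    [c < T], since [I^a phi] converges at some point beyond [c]; so [I^b f]
    is its indefinite integral, and Lebesgue's differentiation theorem gives
    back [phi] as the derivative of [I^b f] almost everywhere
    (abel_solution_derive). If moreover [phi] lies in the Morrey space, it is
    integrable up to [T], because A_1^+ makes the weight locally integrable
    (in_morrey_integrable), and its indefinite integral is absolutely
    continuous on [0, T].

    Sufficiency: an absolutely continuous [F] with [F 0 = 0] is the indefinite
    integral of some [g] (abs_continuous_density). This is shown by splitting
    [F] into its variation function [V] and [V - F], both nondecreasing and
    absolutely continuous; their Lebesgue-Stieltjes measures are dominated by
    Lebesgue measure and so have Radon-Nikodym densities. If [F = I^b f], then
    [f] and [I^a g] have the same image under [I^b], and the inversion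
    identity, with the roles of [a] and [b] exchanged, shows that they have
    the same indefinite integral, hence agree almost everywhere
    (abel_condition_ae_eq).

    The data of the problem agree with Borel functions only almost everywhere.
    Integrals are therefore compared by means of ae_congr_integral, and
    Fubini's theorem is applied to Borel representatives. *)

Local Open Scope classical_set_scope.
Local Open Scope ring_scope.

(** * Integrals of functions that are only almost everywhere Borel *)

Section nonmeasurable_integral.
Set Implicit Arguments.
Unset Strict Implicit.
Local Open Scope ereal_scope.
Context d (T : measurableType d) (R : realType).
Variable mu : {measure set T -> \bar R}.
Implicit Types (f g : T -> \bar R) (D : set T).

Import HBNNSimple.

(** A simple function below [f] lies below [g] once it is set to zero on a
    Borel null set, and this does not change its integral. So the suprema that
    define the two integrals compare, for arbitrary functions. *)
Lemma ge0_ae_le_integral D f g :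
  (forall x, D x -> 0 <= f x) -> (forall x, D x -> 0 <= g x) ->
  {ae mu, forall x, D x -> f x <= g x} ->
  \int[mu]_(x in D) f x <= \int[mu]_(x in D) g x.
Proof.
move=> f0 g0 [N [mN N0 sN]].
rewrite ge0_integralE// [leRHS]ge0_integralE//.
apply: ge_ereal_sup => _ [h /= hf <-].
have [h' h'E] : exists h' : {nnsfun T >-> R},
    forall x, h' x = (h x * \1_(~` N) x)%R.
  by exists (mul_nnsfun h (indic_nnsfun R (measurableC mN))).
apply: (@le_trans _ _ (sintegral mu h')).
  rewrite -!integralT_nnsfun le_eqVlt; apply/orP; left; apply/eqP.
  apply: ge0_ae_eq_integral => //.
  - exact/measurable_EFinP.
  - exact/measurable_EFinP.
  - by move=> x _; rewrite lee_fin.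
  - by move=> x _; rewrite lee_fin.
  exists N; split => // x /= /not_implyP[_]; apply: contra_notP => Nx.
  by rewrite h'E indicE mem_set// mulr1.
apply: ereal_sup_ubound; exists h' => //= x.
rewrite h'E indicE; have [xN|xN] := boolP (x \in ~` N); last first.
  rewrite mulr0 patchE; case: ifPn => // /set_mem; exact: g0.
rewrite mulr1 (le_trans (hf x))// !patchE; case: ifPn => // /set_mem Dx.
move/set_mem : xN; apply: contra_notP => fg; apply: sN => /= /(_ Dx).
exact: fg.
Qed.

Lemma ae_congr_integral D f g : {ae mu, forall x, D x -> f x = g x} ->
  \int[mu]_(x in D) f x = \int[mu]_(x in D) g x.
Proof.
move=> fg; rewrite integralE [RHS]integralE; congr (_ - _).
- apply/eqP; rewrite eq_le !ge0_ae_le_integral//.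
  + by apply: filterS fg => x /[apply]; rewrite !funeposE => ->.
  + by apply: filterS fg => x /[apply]; rewrite !funeposE => ->.
- apply/eqP; rewrite eq_le !ge0_ae_le_integral//.
  + by apply: filterS fg => x /[apply]; rewrite !funenegE => ->.
  + by apply: filterS fg => x /[apply]; rewrite !funenegE => ->.
Qed.

End nonmeasurable_integral.

(** Stated for [lebesgue_measure] itself: unification does not find the
    instance through the type of its sigma-algebra. *)
#[export] Instance ae_lebesgue_filter (R : realType) :
  Filter (almost_everywhere (@lebesgue_measure R)) :=
  ae_filter_ringOfSetsType (@lebesgue_measure R).

Section lebesgue_integrable.
Set Implicit Arguments.
Unset Strict Implicit.
Context {R : realType}.
Local Notation mu := (@lebesgue_measure R).
Implicit Types (D : set R) (g p : R -> R).

Lemma lebesgue_measurable_congr D g1 g2 :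
  {ae mu, forall x, D x -> g1 x = g2 x} ->
  lebesgue_measurable D g1 -> lebesgue_measurable D g2.
Proof.
move=> g12 [g0 mg0 g10]; exists g0 => //.
by apply: filterS2 g12 g10 => x + + Dx => /(_ Dx) <- /(_ Dx).
Qed.

Lemma lebesgue_integrable_congr D g1 g2 :
  {ae mu, forall x, D x -> g1 x = g2 x} ->
  lebesgue_integrable D g1 -> lebesgue_integrable D g2.
Proof.
move=> g12 [mg1 ig1]; split; first exact: lebesgue_measurable_congr g12 mg1.
rewrite (le_lt_trans _ ig1)// ge0_ae_le_integral//.
by apply: filterS g12 => x /[apply] ->.
Qed.

(** Borel representatives that vanish off [D] and are integrable on the whole
    line: the measure theory below is done with these. *)
Lemma lebesgue_integrable_repr D g : measurable D -> lebesgue_integrable D g ->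
  exists p, [/\ measurable_fun [set: R] p, mu.-integrable [set: R] (EFin \o p),
    {ae mu, forall x, D x -> g x = p x} & forall x, ~ D x -> p x = 0].
Proof.
move=> mD [[g0 mg0 gg0] ig].
exists (g0 \_ D).
have mp : measurable_fun [set: R] (g0 \_ D).
  exact/(measurable_restrictT _ _).1.
split=> //.
- apply/integrableP; split; first exact/measurable_EFinP.
  apply: le_lt_trans ig; rewrite [leRHS]integral_mkcond.
  apply: ge0_ae_le_integral => //.
    by move=> x _; rewrite patchE; case: ifP.
  apply: filterS gg0 => x gg0 _ /=; rewrite !patchE.
  by case: ifPn => [/set_mem Dx|_]; [rewrite gg0|rewrite normr0].
- by apply: filterS gg0 => x gg0 Dx; rewrite patchE mem_set// gg0.
- by move=> x nDx; rewrite patchE memNset.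
Qed.

Lemma repr_lebesgue_integrable D g p : measurable D ->
  mu.-integrable D (EFin \o p) ->
  {ae mu, forall x, D x -> g x = p x} -> lebesgue_integrable D g.
Proof.
move=> mD /integrableP[/measurable_EFinP mp ip] gp; split; first by exists p.
apply: le_lt_trans ip; apply: ge0_ae_le_integral => //.
by apply: filterS gp => x /[apply] ->.
Qed.

Lemma lebesgue_integrableS D D' g :
  measurable D -> measurable D' -> D' `<=` D ->
  lebesgue_integrable D g -> lebesgue_integrable D' g.
Proof.
move=> mD mD' DD /(lebesgue_integrable_repr mD)[p [mp ip gp _]].
apply: (@repr_lebesgue_integrable _ _ p) => //.
- exact: integrableS ip.
- by apply: filterS gp => x + /DD.
Qed.

Lemma ae_congr_Rintegral D g p : {ae mu, forall x, D x -> g x = p x} ->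
  \int[mu]_(x in D) g x = \int[mu]_(x in D) p x.
Proof.
move=> gp; rewrite /Rintegral; congr fine; apply: ae_congr_integral.
by apply: filterS gp => x /[apply] ->.
Qed.

End lebesgue_integrable.

(** * Affine changes of variables *)

Section affine_change_of_variables.
Set Implicit Arguments.
Unset Strict Implicit.
Context {R : realType}.
Local Notation mu := (@lebesgue_measure R).
Local Open Scope ereal_scope.

Lemma measurable_shift (s : R) :
  measurable_fun [set: R] (fun x : R => x + s : measurableTypeR R)%R.
Proof. exact: measurable_funD. Qed.

Lemma ge0_integral_shift (s : R) (f : R -> \bar R) :
  measurable_fun [set: R] f -> (forall x, 0 <= f x) ->
  \int[mu]_x f (x + s)%R = \int[mu]_x f x.
Proof.
move=> mf f0.
pose h := (fun x : R => x + s : measurableTypeR R)%R.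
have mh : measurable_fun [set: measurableTypeR R] h by exact: measurable_shift.
transitivity (\int[pushforward mu h]_x f x).
  by rewrite ge0_integral_pushforward//= preimage_setT.
(* Lebesgue measure is determined by its values on the intervals ]a, b]. *)
apply: eq_measure_integral => //= A mA _; apply/esym.
apply: (@lebesgue_measure_unique R (pushforward mu h)) => //= _ [[a b]] _ <-.
rewrite /pushforward (_ : _ @^-1` _ = `]a - s, b - s]%classic)%R; last first.
  by apply/seteqP; split => x /=; rewrite !in_itv/= ltrBlDr lerBrDr.
rewrite !lebesgue_measure_itv/= !lte_fin ltrD2r.
by case: ifP => // _; rewrite -!EFinB; congr EFin; ring.
Qed.

Lemma ge0_integral_scale (c : R) (f : R -> \bar R) : (0 < c)%R ->
  measurable_fun [set: R] f -> (forall x, 0 <= f x) ->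
  c%:E * \int[mu]_x f (c * x)%R = \int[mu]_x f x.
Proof.
move=> c0 mf f0.
pose h := (fun x : R => c * x : measurableTypeR R)%R.
have mh : measurable_fun [set: measurableTypeR R] h by exact: measurable_funM.
pose c' := NngNum (ltW c0).
pose m' := (mscale c' (pushforward mu h)
  : {measure set (measurableTypeR R) -> \bar R}).
pose m := m' mh.
transitivity (\int[m]_x f x).
  rewrite ge0_integral_mscale//=; congr (_ * _).
  by rewrite ge0_integral_pushforward//= preimage_setT.
apply: eq_measure_integral => //= A mA _; apply/esym.
apply: (@lebesgue_measure_unique R m) => //= _ [[a b]] _ <-.
rewrite /m/m'/= /mscale/= /pushforward.
rewrite (_ : _ @^-1` _ = `]a / c, b / c]%classic)%R; last first.
  apply/seteqP; split => x /=; rewrite !in_itv/= ltr_pdivrMr// ler_pdivlMr//;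
    by rewrite ![(_ * c)%R]mulrC.
rewrite !lebesgue_measure_itv/= !lte_fin ltr_pM2r ?invr_gt0//.
case: ifP => // _; last by rewrite mule0.
by rewrite -!EFinB -EFinM; congr EFin; field; rewrite gt_eqF.
Qed.

End affine_change_of_variables.

(** * The kernels of fractional integration and the Gamma function *)

Section kernel.
Set Implicit Arguments.
Unset Strict Implicit.
Context {R : realType}.
Local Notation mu := (@lebesgue_measure R).
Implicit Types a b c t x y : R.

(** Fractional integration of order [a] is convolution with this kernel,
    divided by [Gamma a]. Extending [t^(a-1)] by 0 turns the integrals over
    (0, x) into integrals over the line, where the kernel is homogeneous. *)
Definition rl_kernel a t : R := if 0 < t then t `^ (a - 1) else 0.

Lemma rl_kernel_ge0 a t : 0 <= rl_kernel a t.
Proof. by rewrite /rl_kernel; case: ifP => // _; exact: powR_ge0. Qed.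

Lemma rl_kernel_gt0 a t : 0 < t -> 0 < rl_kernel a t.
Proof. by move=> t0; rewrite /rl_kernel t0 powR_gt0. Qed.

Lemma le0_rl_kernel a t : t <= 0 -> rl_kernel a t = 0.
Proof. by move=> t0; rewrite /rl_kernel ltNge t0. Qed.

Lemma measurable_rl_kernel a : measurable_fun [set: R] (rl_kernel a).
Proof.
apply: measurable_fun_ifT => //; exact: measurable_fun_ltr.
Qed.

Lemma rl_kernelM a c t : 0 < c ->
  rl_kernel a (c * t) = c `^ (a - 1) * rl_kernel a t.
Proof.
move=> c0; rewrite /rl_kernel pmulr_rgt0//.
case: ifPn => t0; last by rewrite mulr0.
by rewrite powRM// ltW.
Qed.

(** The primitive [t^a / a] bounds the integrals over [[1 / (n + 2), 1]], and
    these increase to the integral over (0, 1]. *)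
Lemma integral_rl_kernel01 a : 0 < a ->
  (\int[mu]_(t in `]0%R, 1%R]) (rl_kernel a t)%:E <= (a^-1)%:E)%E.
Proof.
move=> a0.
have -> : `]0, 1]%classic = \bigcup_n `[(n.+2%:R)^-1 : R, 1]%classic.
  apply/seteqP; split => [x /=|x [n _] /=]; rewrite !in_itv/= => /andP[x0 x1].
    have [n nx] := ltr_add_invr x0.
    exists n => //=; rewrite in_itv/= x1 andbT.
    move: nx; rewrite add0r => /ltW; apply: le_trans.
    by rewrite lef_pV2 ?posrE// ler_nat leqnSn.
  by rewrite x1 (lt_le_trans _ x0)// invr_gt0.
have mk : measurable_fun [set: R] (EFin \o rl_kernel a).
  apply/measurable_EFinP; exact: measurable_rl_kernel.
have k0 t : (0 <= (EFin \o rl_kernel a) t)%E by rewrite lee_fin rl_kernel_ge0.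
have cv := @ge0_nondecreasing_set_cvg_integral _ (measurableTypeR R) _
  (fun n => `[(n.+2%:R)^-1 : R, 1]%classic) (EFin \o rl_kernel a) mu.
have {}cv := cv _ (fun=> measurable_itv _) (fun=> measurable_funTS mk)
  (fun _ x _ => k0 x).
rewrite -(cvg_lim _ (cv _))//; last first.
  move=> m n mn; apply/subsetPset; apply: subset_itvr.
  by rewrite bnd_simp lef_pV2 ?posrE// ler_nat.
apply: lime_le.
  apply/cvg_ex; eexists; apply: cv => m n mn; apply/subsetPset.
  by apply: subset_itvr; rewrite bnd_simp lef_pV2 ?posrE// ler_nat.
apply: nearW => n; set e := (n.+2%:R)^-1 : R.
have e0 : 0 < e by rewrite invr_gt0.
have e1 : e < 1 by rewrite invf_lt1// ltr1n.
have dF x : 0 < x -> is_derive x 1 (fun t => a^-1 * t `^ a) (x `^ (a - 1)).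
  move=> x0; have := is_deriveZ (a^-1 : R) (is_derive1_powR a x0).
  by rewrite /GRing.scale/= mulKf ?gt_eqF.
have cF x : 0 < x -> {for x, continuous (fun t => a^-1 * t `^ a)}.
  move=> /dF[dFx _].
  exact/differentiable_continuous/derivable1_diffP.
rewrite (_ : (\int[mu]_(x in _) _)%E =
    \int[mu]_(x in `[e, 1%R]) (x `^ (a - 1))%:E)%E; last first.
  apply: eq_integral => x; rewrite inE/= in_itv/= => /andP[ex _].
  by rewrite /rl_kernel (lt_le_trans e0 ex).
rewrite (@continuous_FTC2 _ _ (fun t => a^-1 * t `^ a))//.
- rewrite powR1 mulr1 -EFinB lee_fin gerBl.
  by rewrite mulr_ge0 ?invr_ge0 ?powR_ge0// ltW.
- apply: continuous_in_subspaceT => x; rewrite inE/= in_itv/= => /andP[ex _].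
  have x0 : 0 < x := lt_le_trans e0 ex.
  apply: differentiable_continuous; apply/derivable1_diffP.
  by apply: derivable_powR; rewrite in_itv/= x0.
- split.
  + move=> x; rewrite in_itv/= => /andP[ex _].
    by have [] := dF x (lt_trans e0 ex).
  + exact/cvg_at_right_filter/cF.
  + exact/cvg_at_left_filter/cF.
- move=> x; rewrite in_itv/= => /andP[ex _]; rewrite derive1E.
  by have [_ ->] := dF x (lt_trans e0 ex).
Qed.

Lemma measurable_expRN : measurable_fun [set: R] (fun t => expR (- t)).
Proof. by apply: measurableT_comp => //; exact: measurable_expR. Qed.

Lemma integral_expRN :
  (\int[mu]_(t in `]0%R, +oo[) (expR (- t))%:E = 1)%E.
Proof.
rewrite -(@integral_exponential_pdf R 1)// integral_itv_obnd_cbnd; last first.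
  by apply/measurable_funTS/measurable_EFinP; exact: measurable_expRN.
rewrite integral_mkcond; apply: eq_integral => x _.
rewrite /exponential_pdf !patchE; case: ifP => // _.
by rewrite mul1r mulN1r.
Qed.

Lemma measurable_gamma_integrand a :
  measurable_fun [set: R] (fun t => rl_kernel a t * expR (- t)).
Proof.
apply: measurable_funM; first exact: measurable_rl_kernel.
exact: measurable_expRN.
Qed.

Lemma gamma_integralE a :
  (\int[mu]_t (rl_kernel a t * expR (- t))%:E =
   \int[mu]_(t in `]0%R, +oo[) (t `^ (a - 1) * expR (- t))%:E)%E.
Proof.
rewrite [RHS]integral_mkcond; apply: eq_integral => x _.
rewrite patchE /rl_kernel; case: ifPn => x0.
  by rewrite mem_set//= in_itv/= x0.
by rewrite mul0r memNset//= in_itv/= andbT; exact/negP.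
Qed.

(** The integrand is at most [t^(a-1)] on (0, 1] and at most [e^(-t)] beyond. *)
Lemma gamma_integral_lty a : 0 < a < 1 ->
  (\int[mu]_t (rl_kernel a t * expR (- t))%:E < +oo)%E.
Proof.
move=> /andP[a0 a1].
have mk := measurable_rl_kernel a; have mg := measurable_gamma_integrand a.
have ge0 t : 0 <= rl_kernel a t * expR (- t).
  by rewrite mulr_ge0 ?rl_kernel_ge0 ?expR_ge0.
apply: (@le_lt_trans _ _ (\int[mu]_(t in `]0%R, 1%R]) (rl_kernel a t)%:E +
    \int[mu]_(t in `]0%R, +oo[) (expR (- t))%:E)%E); last first.
  rewrite integral_expRN lte_add_pinfty ?ltry//.
  by rewrite (le_lt_trans (integral_rl_kernel01 a0))// ltry.
pose f1 := (fun t => (rl_kernel a t)%:E) \_ `]0, 1].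
pose f2 := (fun t => (expR (- t))%:E) \_ `]0, +oo[.
have f10 x : (0 <= f1 x)%E.
  by rewrite /f1 patchE; case: ifP => // _; rewrite lee_fin rl_kernel_ge0.
have f20 x : (0 <= f2 x)%E.
  by rewrite /f2 patchE; case: ifP => // _; rewrite lee_fin expR_ge0.
rewrite [X in (X + _)%E]integral_mkcond [X in (_ + X)%E]integral_mkcond.
rewrite -/f1 -/f2 -ge0_integralD//; first last.
- by apply/(measurable_restrictT _ _).1 => //;
    apply/measurable_funTS/measurable_EFinP; exact: measurable_expRN.
- by apply/(measurable_restrictT _ _).1 => //;
    apply/measurable_funTS/measurable_EFinP.
apply: ge0_ae_le_integral => //.
- by move=> x _; rewrite lee_fin ge0.
- by move=> x _; rewrite adde_ge0.
apply: aeW => x _; have [x0|x0] := leP x 0.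
  by rewrite le0_rl_kernel// mul0r adde_ge0.
have [x1|x1] := leP x 1.
  rewrite -[leLHS]adde0 leeD// /f1 patchE mem_set/= ?in_itv/= ?x0//.
  by rewrite lee_fin ler_piMr ?rl_kernel_ge0// -expR0 ler_expR oppr_le0 ltW.
rewrite -[leLHS]add0e leeD// /f2 patchE mem_set/= ?in_itv/= ?x0//.
rewrite lee_fin ler_piMl ?expR_ge0// /rl_kernel x0.
by rewrite -[leRHS](powRr0 x) ler_powR ?(ltW x1)// subr_le0 ltW.
Qed.

Lemma GammaE a : 0 < a < 1 ->
  (\int[mu]_t (rl_kernel a t * expR (- t))%:E = (Gamma a)%:E)%E.
Proof.
move=> a01; have := gamma_integral_lty a01.
rewrite /Gamma/Rintegral -gamma_integralE => glty.
rewrite fineK// ge0_fin_numE// integral_ge0// => t _.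
by rewrite lee_fin mulr_ge0 ?rl_kernel_ge0 ?expR_ge0.
Qed.

(** On (0, 1] the integrand is at least [e^(-1)]. *)
Lemma Gamma_gt0 a : 0 < a < 1 -> 0 < Gamma a.
Proof.
move=> a01; rewrite -lte_fin -GammaE//.
apply: (@lt_le_trans _ _ (\int[mu]_(t in `]0%R, 1%R]) (expR (- 1))%:E)%E).
  rewrite integral_cst//= lebesgue_measure_itv/= lte_fin ltr01 -EFinD.
  by rewrite oppr0 addr0 mule1 lte_fin expR_gt0.
rewrite integral_mkcond; apply: ge0_ae_le_integral => //.
- by move=> x _; rewrite patchE; case: ifP => // _; rewrite lee_fin expR_ge0.
- by move=> x _; rewrite lee_fin mulr_ge0 ?rl_kernel_ge0 ?expR_ge0.
apply: aeW => x _; rewrite patchE; case: ifPn => [|_]; last first.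
  by rewrite lee_fin mulr_ge0 ?rl_kernel_ge0 ?expR_ge0.
rewrite inE/= in_itv/= => /andP[x0 x1].
rewrite lee_fin -[leLHS]mul1r ler_pM ?expR_ge0//; last first.
  by rewrite ler_expR lerN2.
move: a01 => /andP[_ a1]; rewrite /rl_kernel x0 -[leLHS](powRr0 x).
by apply: ger_powR; rewrite ?x0//= subr_le0 ltW.
Qed.

End kernel.

(** * The Beta integral *)

Section beta_integral.
Set Implicit Arguments.
Unset Strict Implicit.
Context {R : realType}.
Local Notation mu := (@lebesgue_measure R).
Implicit Types a b c t x y : R.

Let conv a b y := (\int[mu]_t (rl_kernel a t * rl_kernel b (y - t))%:E)%E.

Let conv_ge0 a b y t : 0 <= rl_kernel a t * rl_kernel b (y - t).
Proof. by rewrite mulr_ge0 ?rl_kernel_ge0. Qed.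

Let measurable_conv a b y :
  measurable_fun [set: R] (fun t => rl_kernel a t * rl_kernel b (y - t)).
Proof.
apply: measurable_funM; first exact: measurable_rl_kernel.
apply: measurableT_comp; first exact: measurable_rl_kernel.
exact: measurable_funB.
Qed.

Let conv_le0 a b y : y <= 0 -> conv a b y = 0%E.
Proof.
move=> y0; apply: integral0_eq => t _; have [t0|t0] := leP t 0.
  by rewrite le0_rl_kernel ?mul0r.
by rewrite [X in _ * X]le0_rl_kernel ?mulr0// subr_le0 (le_trans y0)// ltW.
Qed.

(** The substitution [t := y * t] multiplies the two kernels and the measure by
    [y^(a-1)], [y^(b-1)] and [y], whose product is [y^(a+b-1) = 1]. *)
Let conv_scale a b y : 0 < a -> a + b = 1 -> 0 < y ->
  conv a b y = conv a b 1.
Proof.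
move=> a0 ab y0; rewrite /conv -(@ge0_integral_scale _ y)//; first last.
- by move=> t; rewrite lee_fin conv_ge0.
- exact/measurable_EFinP.
under eq_integral => t _.
  rewrite (_ : y - y * t = y * (1 - t)); last by rewrite mulrBr mulr1.
  rewrite !rl_kernelM// mulrACA EFinM; over.
rewrite ge0_integralZl//.
- rewrite muleA -EFinM (_ : y * _ = 1) ?mul1e//.
  rewrite mulrA mulr_powRB1//; last exact: ltW.
  rewrite -powRD; last by rewrite (gt_eqF y0) implybT.
  by rewrite addrA ab subrr powRr0.
- by apply/measurable_EFinP; exact: measurable_conv.
- by move=> t _; rewrite lee_fin conv_ge0.
- by rewrite lee_fin mulr_ge0// powR_ge0.
Qed.

Let gamma_ge0 a t : 0 <= rl_kernel a t * expR (- t).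
Proof. by rewrite mulr_ge0 ?rl_kernel_ge0 ?expR_ge0. Qed.

(** In the double integral for [Gamma a * Gamma b], the shift [t := u - s] of
    the second variable turns the two exponentials into [e^(-u)]. After the
    exchange of the integrals the inner one is the convolution at [u], which is
    constant for [u > 0], and what remains is the integral of [e^(-u)]. *)
Let conv1E a b : 0 < a < 1 -> a + b = 1 ->
  conv a b 1 = (Gamma a * Gamma b)%:E.
Proof.
move=> a01 ab; have b01 : 0 < b < 1.
  by move: a01 => /andP[? ?]; apply/andP; split; lra.
have mg c := @measurable_gamma_integrand R c.
pose h (z : measurableTypeR R * measurableTypeR R) :=
  (rl_kernel a z.1 * rl_kernel b (z.2 - z.1) * expR (- z.2))%:E.
have h0 z : (0 <= h z)%E by rewrite lee_fin mulr_ge0 ?expR_ge0.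
have mh : measurable_fun [set: measurableTypeR R * measurableTypeR R] h.
  apply/measurable_EFinP; apply: measurable_funM; [apply: measurable_funM|].
  - exact: measurableT_comp (measurable_rl_kernel _) measurable_fst.
  - apply: (measurableT_comp (measurable_rl_kernel _)).
    by apply: measurable_funB; [exact: measurable_snd|exact: measurable_fst].
  - exact: measurableT_comp measurable_expRN measurable_snd.
rewrite EFinM -!GammaE// -ge0_integralZr//; first last.
- by apply: integral_ge0 => t _; rewrite lee_fin.
- by move=> t _; rewrite lee_fin.
- by apply/measurable_EFinP; exact: mg.
transitivity (\int[mu]_s \int[mu]_u h (s, u))%E; last first.
  apply: eq_integral => s _.
  rewrite -(@ge0_integral_shift _ (- s)
    (fun t => (rl_kernel b t * expR (- t))%:E))//; first last.
  - by move=> t; rewrite lee_fin.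
  - by apply/measurable_EFinP; exact: mg.
  rewrite -ge0_integralZl//; first last.
  - by rewrite lee_fin.
  - by move=> t _; rewrite lee_fin.
  - apply/measurable_EFinP.
    exact: (measurableT_comp (mg b) (measurable_shift (- s))).
  apply: eq_integral => u _; rewrite /h/= -EFinM mulrACA -expRD.
  by rewrite (_ : - s - (u - s) = - u)//; ring.
rewrite (fubini_tonelli h)//.
transitivity (\int[mu]_(u in `]0%R, +oo[) ((expR (- u))%:E * conv a b 1))%E.
  rewrite ge0_integralZr//.
  - by rewrite integral_expRN mul1e.
  - by apply/measurable_EFinP/measurable_funTS; exact: measurable_expRN.
  - by apply: integral_ge0 => t _; rewrite lee_fin.
rewrite integral_mkcond; apply: eq_integral => u _.
transitivity ((expR (- u))%:E * conv a b u)%E.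
  rewrite patchE; case: ifPn => [|u0].
    rewrite inE/= in_itv/= andbT => u0; congr (_ * _)%E.
    by rewrite (conv_scale _ ab u0)//; case/andP : a01.
  rewrite conv_le0 ?mule0//; move: u0.
  by rewrite notin_setE/= in_itv/= andbT => /negP; rewrite -leNgt.
rewrite /conv -ge0_integralZl//.
- by apply: eq_integral => s _; rewrite /h/= -EFinM mulrC.
- by apply/measurable_EFinP; exact: measurable_conv.
- by move=> s _; rewrite lee_fin.
Qed.

(** This is the value [B(a, 1 - a) = Gamma a * Gamma (1 - a)] of the Beta
    integral. *)
Lemma rl_kernel_convolution a b y : 0 < a < 1 -> a + b = 1 ->
  (\int[mu]_t (rl_kernel a t * rl_kernel b (y - t))%:E =
   if (0 < y)%R then (Gamma a * Gamma b)%:E else 0)%E.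
Proof.
move=> a01 ab; have [y0|y0] := ltP 0 y; last exact: conv_le0.
rewrite -conv1E//; apply: conv_scale => //; by case/andP : a01.
Qed.

End beta_integral.

(** * Fubini's theorem for Abel's double integral *)

Section abel_fubini.
Set Implicit Arguments.
Unset Strict Implicit.
Context {R : realType}.
Local Notation mu := (@lebesgue_measure R).
Variables (a b x : R) (p : R -> R).
Hypotheses (a01 : 0 < a < 1) (ab : a + b = 1).
Hypotheses (mp : measurable_fun [set: R] p).
Hypothesis ip : mu.-integrable [set: R] (EFin \o p).
Hypothesis p0 : forall s, ~ (0 < s < x) -> p s = 0.

Let b01 : 0 < b < 1.
Proof.
have -> : b = 1 - a by rewrite -ab addrC addKr.
by move: a01 => /andP[? ?]; rewrite subr_gt0 gtrBl; apply/andP.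
Qed.

(** The integrand of [I^b (I^a p) x] up to the Gamma factors, with [z.1] the
    outer variable. *)
Let K (z : measurableTypeR R * measurableTypeR R) :=
  rl_kernel b (x - z.1) * (p z.2 * rl_kernel a (z.1 - z.2)).

Let mK : measurable_fun [set: measurableTypeR R * measurableTypeR R] K.
Proof.
apply: measurable_funM; last apply: measurable_funM.
- apply: (measurableT_comp (measurable_rl_kernel _)).
  by apply: measurable_funB => //; exact: measurable_fst.
- exact: (measurableT_comp mp measurable_snd).
- apply: (measurableT_comp (measurable_rl_kernel _)).
  by apply: measurable_funB; [exact: measurable_fst|exact: measurable_snd].
Qed.

(** For fixed inner variable [s], the factor of [K] other than [p s]; its
    integral is the Beta integral, translated by [s]. *)
Let kk s t := rl_kernel a (t - s) * rl_kernel b (x - t).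

Let mkk s : measurable_fun [set: R] (kk s).
Proof.
apply: measurable_funM; apply: (measurableT_comp (measurable_rl_kernel _)).
  exact: measurable_funB.
exact: measurable_funB.
Qed.

Let kk_ge0 s t : 0 <= kk s t.
Proof. by rewrite mulr_ge0 ?rl_kernel_ge0. Qed.

Let integral_kk s : 0 < s < x ->
  (\int[mu]_t (kk s t)%:E = (Gamma a * Gamma b)%:E)%E.
Proof.
move=> /andP[_ sx]; rewrite -(@ge0_integral_shift _ s)//; first last.
- by move=> t; rewrite lee_fin kk_ge0.
- by apply/measurable_EFinP; exact: mkk.
have := rl_kernel_convolution (x - s) a01 ab; rewrite subr_gt0 sx => <-.
apply: eq_integral => t _; rewrite /kk addrK; congr (_ * rl_kernel _ _)%:E.
by rewrite opprD addrA addrAC.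
Qed.

Let integrable_kk s : 0 < s < x -> mu.-integrable [set: R] (EFin \o kk s).
Proof.
move=> sx; apply/integrableP; split.
  by apply/measurable_EFinP; exact: mkk.
under eq_integral do rewrite /= ger0_norm ?kk_ge0//.
by rewrite integral_kk// ltry.
Qed.

Let KE s t : K (t, s) = p s * kk s t.
Proof. by rewrite /K/kk/=; ring. Qed.

Let integral_K s :
  (\int[mu]_t (K (t, s))%:E = (Gamma a * Gamma b)%:E * (p s)%:E)%E.
Proof.
under eq_integral do rewrite KE EFinM.
have [sx|/negP sx] := boolP (0 < s < x); last first.
  by rewrite p0// mule0; apply: integral0_eq => t _; rewrite mul0e.
by rewrite integralZl//; [rewrite integral_kk// muleC|exact: integrable_kk].
Qed.

Let integral_normK s :
  (\int[mu]_t `|(K (t, s))%:E| = (Gamma a * Gamma b)%:E * `|(p s)%:E|)%E.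
Proof.
under eq_integral do rewrite KE EFinM abseM.
have [sx|/negP sx] := boolP (0 < s < x); last first.
  by rewrite p0// abse0 mule0; apply: integral0_eq => t _; rewrite mul0e.
rewrite ge0_integralZl//.
- rewrite muleC -(integral_kk sx); congr (_ * _)%E; apply: eq_integral => t _.
  by rewrite gee0_abs// lee_fin kk_ge0.
- by apply: measurableT_comp => //; apply/measurable_EFinP; exact: mkk.
Qed.

Let Gamma_prod_gt0 : 0 < Gamma a * Gamma b.
Proof. by rewrite mulr_gt0 ?Gamma_gt0. Qed.

Let iK : (mu \x mu)%E.-integrable setT (EFin \o K).
Proof.
apply/integrable21ltyP; first by apply/measurable_EFinP; exact: mK.
rewrite (_ : (\int[mu]_s _)%E =
    (\int[mu]_s ((Gamma a * Gamma b)%:E * `|(p s)%:E|))%E); last first.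
  by apply: eq_integral => s _; exact: integral_normK.
rewrite ge0_integralZl//.
- by case/integrableP : ip => _ ?; rewrite lte_mul_pinfty// lee_fin ltW.
- by apply: measurableT_comp => //; apply/measurable_EFinP; exact: mp.
- by rewrite lee_fin ltW.
Qed.

Let H t := (\int[mu]_s (K (t, s))%:E)%E.

(** By Tonelli almost every section of [K] is integrable, and for [t < x] the
    outer kernel is a nonzero constant factor of the section at [t]. *)
Lemma ae_integrable_abel : {ae mu, forall t, t < x ->
  mu.-integrable [set: R] (fun s => (p s * rl_kernel a (t - s))%:E)}.
Proof.
have := ae_integrable1 iK; apply: filterS => t it tx.
have k0 : 0 < rl_kernel b (x - t) by rewrite rl_kernel_gt0// subr_gt0.
have := integrableZl measurableT (rl_kernel b (x - t))^-1 it.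
apply: eq_integrable => // s _.
by rewrite /= -EFinM /K/= mulKf// gt_eqF.
Qed.

(** The function [q] is the integrand of [I^b (I^a p) x] up to the factor
    [(Gamma a)^-1], in a Borel version. *)
Lemma abel_fubini : exists q : R -> R,
  [/\ mu.-integrable [set: R] (EFin \o q),
      {ae mu, forall t, q t =
        rl_kernel b (x - t) * \int[mu]_s (p s * rl_kernel a (t - s))} &
      \int[mu]_t q t = Gamma a * Gamma b * \int[mu]_s p s].
Proof.
have iH := integrable_fubini_F iK.
have HE : {ae mu, forall t, (fine (H t))%:E = H t}.
  have := ae_integrable1 iK; apply: filterS => t it.
  by rewrite fineK//; exact: integrable_fin_num it.
have HE' : {ae mu, forall t, [set: R] t -> (EFin \o (fine \o H)) t = H t}.
  by apply: filterS HE => t.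
exists (fine \o H); split.
- apply/integrableP; split.
    apply/measurable_EFinP; apply: measurableT_comp => //.
    by case/integrableP : iH.
  rewrite (_ : (\int[mu]_t _)%E = \int[mu]_t `|H t|)%E.
    by case/integrableP : iH.
  by apply: ae_congr_integral; apply: filterS HE => t Ht _; rewrite -[in RHS]Ht.
- have := ae_integrable_abel; apply: filterS => t it.
  have [tx|tx] := ltP t x; last first.
    rewrite [X in X * _]le0_rl_kernel ?mul0r ?subr_le0//= /H integral0_eq//.
    by move=> s _; rewrite /K/= le0_rl_kernel ?mul0r ?subr_le0.
  by rewrite -RintegralZl//; last exact: it.
- rewrite /Rintegral (ae_congr_integral HE').
  rewrite [X in fine X](integral12_prod_meas1 iK) -(integral21_prod_meas1 iK).
  rewrite (_ : (\int[mu]_s _)%E =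
      (\int[mu]_s ((Gamma a * Gamma b)%:E * (p s)%:E))%E); last first.
    by apply: eq_integral => s _; exact: integral_K.
  by rewrite integralZl// fineM//; exact: integrable_fin_num.
Qed.

End abel_fubini.

(** * Riemann-Liouville integrals and Abel's inversion *)

Section riemann_liouville.
Set Implicit Arguments.
Unset Strict Implicit.
Context {R : realType}.
Local Notation mu := (@lebesgue_measure R).
Implicit Types (a b c t x : R) (f g p phi : R -> R).

Lemma RL_integrandE a g x t : t < x ->
  RL_integrand a g x t = g t * rl_kernel a (x - t).
Proof.
by move=> tx; rewrite /RL_integrand /rl_kernel subr_gt0 tx -powRN opprB.
Qed.

Lemma RL_integral_congr a g1 g2 c x : x <= c ->
  {ae mu, forall t, 0 < t < c -> g1 t = g2 t} ->
  RL_integral a g1 x = RL_integral a g2 x.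
Proof.
move=> xc g12; rewrite /RL_integral; congr (_ * _); apply: ae_congr_Rintegral.
apply: filterS g12 => t + /=; rewrite in_itv/= => g12 /andP[t0 tx].
by rewrite /RL_integrand g12// t0 (lt_le_trans tx).
Qed.

Lemma RL_defined_congr a g1 g2 c x : x <= c ->
  {ae mu, forall t, 0 < t < c -> g1 t = g2 t} ->
  RL_defined a g1 x -> RL_defined a g2 x.
Proof.
move=> xc g12; apply: lebesgue_integrable_congr.
apply: filterS g12 => t + /=; rewrite in_itv/= => g12 /andP[t0 tx].
by rewrite /RL_integrand g12// t0 (lt_le_trans tx).
Qed.

Lemma RL_integral_line a p x : (forall s, s <= 0 -> p s = 0) ->
  RL_integral a p x = (Gamma a)^-1 * \int[mu]_s (p s * rl_kernel a (x - s)).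
Proof.
move=> p0; rewrite /RL_integral Rintegral_mkcond; congr (_ * _).
apply: eq_Rintegral => s _; rewrite patchE; case: ifPn.
  by rewrite inE/= in_itv/= => /andP[_ sx]; rewrite RL_integrandE.
rewrite notin_setE/= in_itv/= => /negP; rewrite negb_and -!leNgt.
case/orP => [s0|xs]; first by rewrite p0// mul0r.
by rewrite le0_rl_kernel ?mulr0// subr_le0.
Qed.

Lemma RL_defined_line a p x :
  mu.-integrable [set: R] (fun s => (p s * rl_kernel a (x - s))%:E) ->
  RL_defined a p x.
Proof.
move=> ip; pose w s := p s * rl_kernel a (x - s).
apply: (@repr_lebesgue_integrable _ _ _ w).
- exact: measurable_itv.
- exact: integrableS ip.
- by apply: aeW => s /=; rewrite in_itv/= => /andP[_ sx]; exact: RL_integrandE.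
Qed.

Lemma ae_RL_defined a phi x : 0 < a < 1 -> lebesgue_integrable `]0, x[ phi ->
  {ae mu, forall t, 0 < t < x -> RL_defined a phi t}.
Proof.
move=> a01 /lebesgue_integrable_repr[]// p [mp ip phip p0].
have p0' s : ~ 0 < s < x -> p s = 0 by move=> ?; apply: p0; rewrite /= in_itv.
have := @ae_integrable_abel R a (1 - a) x p a01 (subrKC _ _) mp ip p0'.
apply: filterS => t it /andP[_ tx].
have /RL_defined_line := it tx.
apply: (@RL_defined_congr _ _ _ x); first exact: ltW.
by apply: filterS phip => s; rewrite /= in_itv/= => /[apply].
Qed.

(** Abel's inversion: applying [I^b] with [b = 1 - a] to [I^a phi] and
    exchanging the two integrations leaves the Beta integral of the kernels,
    a constant, in front of the integral of [phi]. *)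
Lemma abel_inversion a b phi f x : 0 < a < 1 -> a + b = 1 ->
  lebesgue_integrable `]0, x[ phi ->
  {ae mu, forall t, 0 < t < x -> f t = RL_integral a phi t} ->
  RL_defined b f x /\ RL_integral b f x = \int[mu]_(t in `]0, x[) phi t.
Proof.
move=> a01 ab /lebesgue_integrable_repr[]// p [mp ip phip p0] fphi.
have p0' s : ~ 0 < s < x -> p s = 0 by move=> ?; apply: p0; rewrite /= in_itv.
have b01 : 0 < b < 1.
  have -> : b = 1 - a by rewrite -ab addrC addKr.
  by move: a01 => /andP[? ?]; rewrite subr_gt0 gtrBl; apply/andP.
have [q [iq qE Iq]] := abel_fubini a01 ab mp ip p0'.
have phip' : {ae mu, forall s, 0 < s < x -> phi s = p s}.
  by apply: filterS phip => s; rewrite /= in_itv/= => /[apply].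
have fq : {ae mu, forall t, `]0, x[%classic t ->
    RL_integrand b f x t = (Gamma a)^-1 * q t}.
  apply: filterS2 fphi qE => t ft qt; rewrite /= in_itv/= => tx.
  case/andP: (tx) => t0 tx'; rewrite RL_integrandE// ft//.
  rewrite (RL_integral_congr _ (ltW tx') phip') RL_integral_line; last first.
    by move=> s s0; apply: p0'; rewrite ltNge s0.
  by rewrite qt; ring.
have q0 : {ae mu, forall t, ~ `]0, x[%classic t -> q t = 0}.
  apply: filterS qE => t -> /=.
  rewrite in_itv/= => /negP; rewrite negb_and -!leNgt.
  case/orP => [t0|xt]; last by rewrite le0_rl_kernel ?mul0r// subr_le0.
  rewrite /Rintegral integral0_eq ?mulr0// => s _; have [s0|s0] := leP s 0.
    by rewrite p0' ?mul0r// ltNge s0.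
  by rewrite le0_rl_kernel ?mulr0// subr_le0 (le_trans t0)// ltW.
split.
  apply: (repr_lebesgue_integrable _ _ fq) => //.
  have iq' := integrableZl measurableT (Gamma a)^-1 iq.
  exact: integrableS iq'.
rewrite /RL_integral (ae_congr_Rintegral fq) Rintegral_mkcond.
rewrite (@ae_congr_Rintegral _ _ _ (fun t => (Gamma a)^-1 * q t)); last first.
  apply: filterS q0 => t qt _; rewrite patchE; case: ifPn => //.
  by rewrite notin_setE => /qt ->; rewrite mulr0.
rewrite RintegralZl// Iq (ae_congr_Rintegral phip) [in RHS]Rintegral_mkcond.
have -> : \int[mu]_s (p \_ `]0, x[) s = \int[mu]_s p s.
  by apply: eq_Rintegral => s _; rewrite patchE; case: ifPn => //;
    rewrite notin_setE => /p0.
have := Gamma_gt0 a01; have := Gamma_gt0 b01 => gb ga.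
by field; rewrite (gt_eqF ga) (gt_eqF gb).
Qed.

(** On (0, x) the factor [(x - t)^(1-a)] that takes the integrand back to [phi]
    is bounded by [x^(1-a)]. *)
Lemma RL_defined_integrable a phi x : 0 < a < 1 ->
  RL_defined a phi x -> lebesgue_integrable `]0, x[ phi.
Proof.
move=> /andP[a0 a1] /lebesgue_integrable_repr[]// p [mp ip phip p0].
pose w t := p t * (x - t) `^ (1 - a).
apply: (@repr_lebesgue_integrable _ _ _ w) => //; last first.
  apply: filterS phip => t pt xt; rewrite /w -pt//.
  move: xt; rewrite /= in_itv/= => /andP[t0 tx].
  by rewrite /RL_integrand mulfVK// gt_eqF// powR_gt0// subr_gt0.
have ip' : mu.-integrable `]0, x[ (EFin \o p) by exact: integrableS ip.
have mI : measurable (`]0, x[%classic : set (measurableTypeR R)).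
  exact: measurable_itv.
have := integrableZl mI (x `^ (1 - a)) ip'.
apply: le_integrable => //.
  apply/measurable_EFinP/measurable_funTS; apply: measurable_funM => //.
  apply: (measurableT_comp (@measurable_powR R (1 - a))).
  exact: measurable_funB.
move=> t; rewrite /= in_itv/= => /andP[t0 tx].
rewrite lee_fin /w !normrM mulrC ler_wpM2r// !ger0_norm ?powR_ge0//.
apply: ge0_ler_powR; rewrite ?nnegrE; lra.
Qed.

End riemann_liouville.

(** * Indefinite integrals *)

Section indefinite_integral.
Set Implicit Arguments.
Unset Strict Implicit.
Context {R : realType}.
Local Notation mu := (@lebesgue_measure R).
Implicit Types (c x : R) (F p phi : R -> R).

(** The countably many intervals (0, c - c / (n + 2)) exhaust (0, c). *)
Lemma ae_interval_exhaust (P : R -> Prop) c : 0 < c ->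
  (forall d, 0 < d < c -> {ae mu, forall x, 0 < x < d -> P x}) ->
  {ae mu, forall x, 0 < x < c -> P x}.
Proof.
move=> c0 Pd; pose d n := c - c / n.+2%:R.
have dc n : 0 < d n < c.
  by rewrite /d subr_gt0 gtrBl divr_gt0// ltr_pdivrMr// ltr_pMr// ltr1n.
have : \forall x \ae mu, forall n, 0 < x < d n -> P x.
  by apply: ae_foralln => n; exact: Pd.
apply: filterS => x Px /andP[x0 xc].
have cx0 : 0 < (c - x) / c by rewrite divr_gt0// subr_gt0.
have [n] := ltr_add_invr cx0; rewrite add0r => nx.
apply: (Px n); rewrite x0 /d ltrBrDr -ltrBrDl.
rewrite -[ltRHS](@divfK _ c) ?gt_eqF// mulrC ltr_pM2r// (le_lt_trans _ nx)//.
by rewrite lef_pV2 ?posrE// ler_nat.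
Qed.

Lemma integral_line p x : mu.-integrable [set: R] (EFin \o p) ->
  (forall s, s <= 0 -> p s = 0) ->
  \int[mu]_(t in `]0, x[) p t = \int[mu]_(t in `]-oo, x]) p t.
Proof.
move=> ip p0; rewrite Rintegral_itv_bndo_bndc; last exact: integrableS ip.
rewrite Rintegral_mkcond [RHS]Rintegral_mkcond; apply: eq_Rintegral => s _.
rewrite !patchE; case: ifPn => [|].
  by rewrite inE/= in_itv/= => /andP[_ sx]; rewrite mem_set//= in_itv.
rewrite notin_setE/= in_itv/= => /negP; rewrite negb_and -!leNgt -ltNge => sx.
case: ifPn => //; rewrite inE/= in_itv/= => xs; case/orP : sx => [/p0->//|].
by rewrite ltNge xs.
Qed.

(** Lebesgue's differentiation theorem. The function [G] is an indefinite
    integral on (0, c) alone, which determines its derivative there. *)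
Lemma ae_derive_integral G phi c : lebesgue_integrable `]0, c[ phi ->
  (forall x, 0 < x < c -> G x = \int[mu]_(t in `]0, x[) phi t) ->
  {ae mu, forall x, 0 < x < c -> derivable G x 1 /\ derive1 G x = phi x}.
Proof.
move=> /lebesgue_integrable_repr[]// p [mp ip phip p0] GE.
have p0' s : s <= 0 -> p s = 0.
  by move=> s0; apply: p0; rewrite /= in_itv/= ltNge s0.
have locp : locally_integrable [set: R] p.
  by have := integrable_locally measurableT ip; rewrite patch_setT.
have ip' y : mu.-integrable `]-oo, y] (EFin \o p) by exact: integrableS ip.
have phip0 := phip.
have := FTC1Ny ip' locp; apply: filterS2 phip => x phip [dP P'] xc.
have GP : {near x, G =1 fun y => \int[mu]_(t in `]-oo, y]) p t}.
  have := @near_in_itvoo _ 0 c x; rewrite in_itv/= => /(_ xc).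
  apply: filterS => y.
  rewrite in_itv/= => yc; rewrite GE// -integral_line//.
  apply: ae_congr_Rintegral; apply: filterS phip0 => s ps.
  rewrite /= in_itv/= => /andP[s0 sy]; apply: ps; rewrite /= in_itv/= s0.
  by rewrite (lt_trans sy)//; case/andP: yc.
split.
  apply: near_eq_derivable dP; apply: filterS GP => y; exact: esym.
rewrite derive1E (near_eq_derive _ GP) -derive1E P' phip//.
Qed.

(** A family of disjoint intervals of small total length is a set of small
    measure, on which the integral of [|p|] is small. *)
Lemma integral_abs_continuous p c d : mu.-integrable [set: R] (EFin \o p) ->
  abs_continuous c d (fun x => \int[mu]_(t in `]-oo, x]) p t).
Proof.
move=> ip e e0; have [r [r0 re]] := integral_normr_continuous ip e0.
exists r => // n u v uv tuv uvr.
set I := fun i : 'I_n => `]u i, v i[%classic : set (measurableTypeR R).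
have mI i : measurable (I i) by exact: measurable_itv.
pose A := \big[setU/set0]_(i < n) I i.
have mA : measurable A by exact: bigsetU_measurable.
have muA : (mu A < r%:E)%E.
  rewrite /A measure_bigsetU_ord//.
  rewrite (eq_bigr (fun i => (v i - u i)%:E)) ?sumEFin ?lte_fin//.
  move=> i _; rewrite /I/= lebesgue_measure_itv/= lte_fin.
  have [_ uvi _] := uv i; move: uvi; rewrite le_eqVlt => /predU1P[->|->//].
  by rewrite ltxx subrr.
have mp : measurable_fun [set: R] (fun x => `|(p x)%:E|%E).
  by apply: measurableT_comp => //; case/integrableP : ip.
have ipI i : mu.-integrable (I i) (EFin \o p) by exact: integrableS ip.
rewrite (le_lt_trans _ (re A mA muA))//.
rewrite -lee_fin -sumEFin /Rintegral fineK; last first.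
  have : mu.-integrable A (EFin \o p) by exact: integrableS ip.
  case/integrableP => _ ?; rewrite ge0_fin_numE//.
  exact: integral_ge0.
rewrite /A ge0_integral_bigsetU//=; last 3 first.
- exact: index_enum_uniq.
- exact: sub_trivIset tuv.
- exact: measurable_funTS.
apply: lee_sum => i _.
have [_ uvi _] := uv i.
have -> : \int[mu]_(t in `]-oo, v i]) p t - \int[mu]_(t in `]-oo, u i]) p t =
    \int[mu]_(t in I i) p t.
  have ipv : mu.-integrable `]-oo, v i] (EFin \o p) by exact: integrableS ip.
  have ipuv : mu.-integrable `]u i, v i[ (EFin \o p) by exact: integrableS ip.
  by rewrite Rintegral_itvB ?bnd_simp// -Rintegral_itv_bndo_bndc.
rewrite -(@fineK _ (\int[mu]_(t in I i) _)%E).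
  by rewrite lee_fin; exact: le_normr_Rintegral.
case/integrableP : (ipI i) => _ ?; rewrite ge0_fin_numE//.
exact: integral_ge0.
Qed.

End indefinite_integral.

(** * Absolute continuity and bounded variation *)

Section absolute_continuity.
Set Implicit Arguments.
Unset Strict Implicit.
Context {R : realType}.
Local Notation mu := (@lebesgue_measure R).
Implicit Types (p q : R * R) (l : seq (R * R)) (s : seq R) (F G : R -> R).

Definition sep p q := (p.2 <= q.1) || (q.2 <= p.1).

Definition nonoverlapping l := all (fun p => p.1 <= p.2) l && pairwise sep l.

Definition total_length l := \sum_(p <- l) (p.2 - p.1).

Definition total_increment F l := \sum_(p <- l) `|F p.2 - F p.1|.

(** Absolute continuity on the whole line, by means of lists of intervals,
    which can be cut and concatenated. A function on [[c, d]] is brought to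
    this form by composition with the retraction [clamp c d]. *)
Definition ac F := forall e, 0 < e -> exists2 d, 0 < d &
  forall l, nonoverlapping l -> total_length l < d -> total_increment F l < e.

Lemma sepC p q : sep p q = sep q p.
Proof. by rewrite /sep orbC. Qed.

Lemma sep_sub p q r : p.1 <= r.1 -> r.2 <= p.2 -> sep p q -> sep r q.
Proof.
move=> pr rp /orP[h|h]; rewrite /sep; first by rewrite (le_trans rp h).
by rewrite (le_trans h pr) orbT.
Qed.

Lemma nonoverlapping_cat l1 l2 : nonoverlapping (l1 ++ l2) =
  [&& nonoverlapping l1, nonoverlapping l2 & allrel sep l1 l2].
Proof.
rewrite /nonoverlapping all_cat pairwise_cat.
by case: all; case: all => //=; rewrite ?andbF ?andbT//; case: pairwise;
   case: pairwise; rewrite ?andbF ?andbT.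
Qed.

Lemma total_length_cat l1 l2 :
  total_length (l1 ++ l2) = total_length l1 + total_length l2.
Proof. by rewrite /total_length big_cat. Qed.

Lemma total_increment_cat F l1 l2 :
  total_increment F (l1 ++ l2) = total_increment F l1 + total_increment F l2.
Proof. by rewrite /total_increment big_cat. Qed.

Lemma total_length_ge0 l : nonoverlapping l -> 0 <= total_length l.
Proof.
move=> /andP[/allP ll _]; rewrite /total_length big_seq sumr_ge0// => p pl.
by rewrite subr_ge0 ll.
Qed.

(** Such maps, for instance the retraction onto an interval, keep intervals
    non-overlapping and do not lengthen them. *)
Definition monotone_contraction (h : R -> R) :=
  {homo h : x y / x <= y} /\ forall x y, x <= y -> h y - h x <= y - x.

Definition pair_map (h : R -> R) p := (h p.1, h p.2).

Lemma contraction_nonoverlapping h l : monotone_contraction h ->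
  nonoverlapping l -> nonoverlapping (map (pair_map h) l).
Proof.
move=> [hh _] /andP[/allP ll pl]; apply/andP; split.
  by apply/allP => _ /mapP[p /ll pp ->]; exact: hh.
rewrite pairwise_map; apply: sub_pairwise pl => p q /=.
by rewrite /sep /= => /orP[/hh ->//|/hh ->]; rewrite orbT.
Qed.

Lemma contraction_total_length h l : monotone_contraction h ->
  nonoverlapping l -> total_length (map (pair_map h) l) <= total_length l.
Proof.
move=> [_ hh] /andP[/allP ll pl]; rewrite /total_length big_map big_seq.
by rewrite [leRHS]big_seq; apply: ler_sum => p /ll; exact: hh.
Qed.

Definition clamp (c d x : R) := if x <= c then c else if d <= x then d else x.

Lemma contraction_clamp c d : c <= d -> monotone_contraction (clamp c d).
Proof.
move=> cd; split => [x y xy|x y xy]; rewrite /clamp;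
  case: (lerP x c) => ?; case: (lerP y c) => ?;
  case: (lerP d x) => ?; case: (lerP d y) => ?; lra.
Qed.

Lemma clamp_itv c d x : c <= d -> c <= clamp c d x <= d.
Proof.
by move=> cd; rewrite /clamp; case: (lerP x c) => ?; case: (lerP d x) => ?; lra.
Qed.

Lemma clamp_id c d x : c <= x <= d -> clamp c d x = x.
Proof.
by move=> /andP[? ?]; rewrite /clamp; case: (lerP x c) => ?;
  case: (lerP d x) => ?; lra.
Qed.

Lemma abs_continuous_ac c d F : c <= d ->
  abs_continuous c d F -> ac (F \o clamp c d).
Proof.
move=> cd acF e e0; have [r r0 re] := acF e e0.
exists r => // l nl lr.
pose l' := map (pair_map (clamp c d)) l.
have cl := contraction_clamp cd.
have nl' : nonoverlapping l' by exact: contraction_nonoverlapping.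
have lr' : total_length l' < r.
  exact: le_lt_trans (contraction_total_length cl nl) lr.
have -> : total_increment (F \o clamp c d) l = total_increment F l'.
  by rewrite /total_increment /l' big_map.
rewrite /total_increment big_tnth; apply: re.
- move=> i; set p := tnth _ i.
  have : p \in l' by exact: mem_tnth.
  move=> pl'; split; last 2 first.
  - by move: nl' => /andP[/allP/(_ _ pl')].
  - by move: pl' => /mapP[q _ ->]; case/andP : (clamp_itv q.2 cd).
  - by move: pl' => /mapP[q _ ->]; case/andP : (clamp_itv q.1 cd).
- move=> i j _ _ [x [/=]]; rewrite !in_itv/= => /andP[xi1 xi2] /andP[xj1 xj2].
  have sepn m n : (m < n < size l')%N ->
      sep (nth (0, 0) l' m) (nth (0, 0) l' n).
    move=> /andP[mn nl0].
    move: nl' => /andP[_ /(pairwiseP (0, 0))]; apply => //.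
    by rewrite inE (ltn_trans mn).
  move: xi1 xi2 xj1 xj2; rewrite !(tnth_nth (0, 0))/= => xi1 xi2 xj1 xj2.
  apply/val_inj; case: (ltngtP i j) => // ij.
  + have := sepn i j; rewrite ij ltn_ord => /(_ isT) /orP[h|h].
      by have := lt_le_trans xi2 h; rewrite ltNge (ltW xj1).
    by have := lt_le_trans xj2 h; rewrite ltNge (ltW xi1).
  + have := sepn j i; rewrite ij ltn_ord => /(_ isT) /orP[h|h].
      by have := lt_le_trans xj2 h; rewrite ltNge (ltW xi1).
    by have := lt_le_trans xi2 h; rewrite ltNge (ltW xj1).
- by move: lr'; rewrite /total_length big_tnth.
Qed.

Lemma acD F G : ac F -> ac G -> ac (F \+ G).
Proof.
move=> acF acG e e0; have e20 : 0 < e / 2 by rewrite divr_gt0.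
have [r r0 rF] := acF _ e20; have [s s0 sG] := acG _ e20.
exists (Num.min r s); first by rewrite lt_min r0.
move=> l nl; rewrite lt_min => /andP[lr ls].
rewrite (splitr e); apply: le_lt_trans (ltrD (rF l nl lr) (sG l nl ls)).
rewrite /total_increment -big_split/=; apply: ler_sum => p _.
by rewrite opprD addrACA ler_normD.
Qed.

Lemma acN F : ac F -> ac (\- F).
Proof.
move=> acF e /acF[r r0 rF]; exists r => // l nl /(rF l nl).
apply: le_lt_trans; apply: ler_sum => p _.
by rewrite -opprD normrN.
Qed.

Definition pieces u s : seq (R * R) :=
  [seq (x.2, x.1) | x <- zip s (u :: s)].

Lemma pieces_cons u x s : pieces u (x :: s) = (u, x) :: pieces x s.
Proof. by []. Qed.

Lemma variation_pieces F u v s : itv_partition u v s ->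
  variation u v F s = total_increment F (pieces u s).
Proof. by move=> uvs; rewrite variation_zip// /total_increment big_map. Qed.

Lemma pieces_itv u v s : itv_partition u v s ->
  forall p, p \in pieces u s -> u <= p.1 /\ p.2 <= v.
Proof.
elim: s u => // x s ih u [/= /andP[ux xs] /eqP sv] p.
have xv : itv_partition x v s by split => //; exact/eqP.
rewrite pieces_cons inE => /predU1P[->/=|/(ih _ xv)[xp pv]].
  by split=> //; exact: itv_partition_le xv.
by split=> //; rewrite (le_trans (ltW ux)).
Qed.

Lemma nonoverlapping_pieces u v s : itv_partition u v s ->
  nonoverlapping (pieces u s) /\ total_length (pieces u s) = v - u.
Proof.
elim: s u => [u|x s ih u [/= /andP[ux xs] /eqP sv]].
  by move=> /itv_partition_nil ->; rewrite /total_length big_nil subrr.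
have xv : itv_partition x v s by split => //; exact/eqP.
have [nx lx] := ih _ xv.
rewrite pieces_cons /total_length big_cons -/(total_length _) lx/=; split.
  rewrite -cat1s nonoverlapping_cat nx /nonoverlapping/= (ltW ux)/= allrel1l.
  apply/allP => p /(pieces_itv xv)[xp _].
  by rewrite /sep xp.
by rewrite addrC subrKA.
Qed.

(** Each total variation in the sum is a supremum over partitions, and the
    pieces of partitions of non-overlapping intervals again form a
    non-overlapping family, of the same total length. *)
Lemma ac_total_variation F e : ac F -> 0 < e -> exists2 d, 0 < d &
  forall l, nonoverlapping l -> total_length l < d ->
    (\sum_(p <- l) total_variation p.1 p.2 F <= e%:E)%E.
Proof.
move=> acF e0; have [d d0 de] := acF e e0; exists d => //.
(* The intervals of A are cut one after the other into the pieces of an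
   arbitrary partition, and the pieces are moved to B. *)
suff H (A B : seq (R * R)) :
    nonoverlapping (A ++ B) -> total_length (A ++ B) < d ->
    (\sum_(p <- A) total_variation p.1 p.2 F + (total_increment F B)%:E
      <= e%:E)%E.
  move=> l nl ld; have := H l [::]; rewrite cats0 => /(_ nl ld).
  by rewrite /total_increment big_nil adde0.
elim: A B => [B nB lB|[u v] A ih B].
  by rewrite big_nil add0e lee_fin ltW// de.
rewrite -cat1s -catA nonoverlapping_cat total_length_cat.
move=> /and3P[n1 n2 n12] l12.
have uv : u <= v by case/andP: n1 => /andP[].
have l2 : total_length (A ++ B) < d.
  by rewrite (le_lt_trans _ l12)// lerDr total_length_ge0.
have fin_tail :
    (\sum_(p <- A) total_variation p.1 p.2 F + (total_increment F B)%:E)%E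
      \is a fin_num.
  rewrite ge0_fin_numE ?(le_lt_trans (ih _ n2 l2)) ?ltry//.
  rewrite adde_ge0// ?lee_fin ?sumr_ge0//.
  rewrite big_seq; apply: sume_ge0 => p pA; apply: total_variation_ge0.
  by case/andP: n2 => /allP + _; apply; rewrite mem_cat pA.
rewrite big_cons/= -addeA -leeBrDr//.
apply: ge_ereal_sup => _ [_ [s uvs <-] <-]; rewrite leeBrDr//.
rewrite variation_pieces// addeCA -EFinD -total_increment_cat.
have [np lp] := nonoverlapping_pieces uvs.
apply: ih; last first.
  by move: l12; rewrite !total_length_cat lp {1}/total_length big_seq1/= addrCA.
move: n12; rewrite allrel1l => /allP uvAB.
move: n2; rewrite !nonoverlapping_cat np allrel_catr.
move=> /and3P[-> -> ->]/=; rewrite andbT.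
have H q r : q \in pieces u s -> r \in A ++ B -> sep q r.
  by move=> /(pieces_itv uvs)[uq qv] /uvAB; exact: sep_sub.
apply/andP; split; apply/allrelP => q r qs rAB.
  by apply: H => //; rewrite mem_cat rAB orbT.
by rewrite sepC; apply: H => //; rewrite mem_cat qs.
Qed.

(** The total variation of an interval of length at most [r / 2] is at most 1,
    for [r] given by absolute continuity with [e = 1]. *)
Lemma ac_bounded_variation F c d : ac F -> c <= d ->
  total_variation c d F \is a fin_num.
Proof.
move=> acF cd; have [r r0 rF] := ac_total_variation acF (@ltr01 R).
have r20 : 0 < r / 2 by rewrite divr_gt0.
have short u v : u <= v -> v - u <= r / 2 -> (total_variation u v F <= 1)%E.
  move=> uv vur; have := rF [:: (u, v)]; rewrite /total_length !big_seq1/=.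
  apply; first by rewrite /nonoverlapping/= uv.
  by rewrite (le_lt_trans vur)// ltr_pdivrMr// ltr_pMr// ltr1n.
suff H n : forall u v, u <= v -> v - u <= n%:R * (r / 2) ->
    (total_variation u v F <= n%:R%:E)%E.
  rewrite ge0_fin_numE ?total_variation_ge0//.
  apply: (le_lt_trans (H (Num.bound ((d - c) / (r / 2))) c d cd _)).
    by rewrite -ler_pdivrMr// ltW// archi_boundP// divr_ge0// ?subr_ge0// ltW.
  by rewrite ltry.
elim: n => [u v uv|n ih u v uv vun].
  rewrite mul0r subr_le0 => vu.
  have -> : u = v by apply/le_anti; rewrite uv.
  by rewrite total_variationxx.
have [vur|vur] := leP (v - u) (r / 2).
  by rewrite (le_trans (short _ _ uv vur))// lee_fin ler1n.
have uw : u <= u + r / 2 by rewrite lerDl ltW.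
have wv : u + r / 2 <= v by rewrite -lerBrDl ltW.
rewrite (total_variationD _ uw wv) -(nat1r n) EFinD leeD//.
  by apply: short => //; rewrite addrC addKr.
by apply: ih => //; move: vun; rewrite -(natr1 n) mulrDl mul1r; lra.
Qed.

End absolute_continuity.

(** * Jordan decomposition and refinement of covers *)

Section jordan.
Set Implicit Arguments.
Unset Strict Implicit.
Context {R : realType}.
Local Notation mu := (@lebesgue_measure R).
Implicit Types (p q : R * R) (l : seq (R * R)) (F G : R -> R).

(** [V] is the total variation from [c] on; its increment over an interval is
    the variation of [F] there, which dominates the increment of [F]. *)
Lemma ac_jordan F c d : c <= d -> ac F -> exists V,
  [/\ {homo V : x y / x <= y}, ac V,
      {homo V \- (F \o clamp c d) : x y / x <= y} &
      ac (V \- (F \o clamp c d))].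
Proof.
move=> cd acF; pose V x := fine (total_variation c (clamp c d x) F).
have [hh hl] := contraction_clamp cd.
have cc x : c <= clamp c d x by case/andP: (clamp_itv x cd).
have fV x y : x <= y -> total_variation x y F \is a fin_num.
  exact: ac_bounded_variation.
have VE x y : x <= y ->
    V y - V x = fine (total_variation (clamp c d x) (clamp c d y) F).
  move=> xy; have xy' := hh _ _ xy.
  rewrite /V (total_variationD _ (cc x) xy') fineD ?fV//.
  by rewrite addrC addKr.
have Vnd : {homo V : x y / x <= y}.
  move=> x y xy; rewrite -subr_ge0 VE// fine_ge0// total_variation_ge0//.
  exact: hh.
have acV : ac V.
  move=> e e0; have e20 : 0 < e / 2 by rewrite divr_gt0.
  have [r r0 rF] := ac_total_variation acF e20; exists r => // l nl lr.
  have cl := contraction_clamp cd.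
  have := rF _ (contraction_nonoverlapping cl nl)
    (le_lt_trans (contraction_total_length cl nl) lr).
  rewrite big_map/= => h; apply: (@le_lt_trans _ _ (e / 2)); last first.
    by rewrite ltr_pdivrMr// ltr_pMr// ltr1n.
  rewrite -lee_fin; apply: le_trans h.
  rewrite /total_increment -sumEFin big_seq [leRHS]big_seq.
  apply: lee_sum => p pl.
  have pp : p.1 <= p.2 by case/andP: nl => /allP /(_ _ pl).
  rewrite VE// ger0_norm ?fine_ge0 ?total_variation_ge0 ?hh//.
  by rewrite fineK// fV// hh.
exists V; split => //.
- move=> x y xy; rewrite -subr_ge0 /=.
  have -> : V y - F (clamp c d y) - (V x - F (clamp c d x)) =
    (V y - V x) - (F (clamp c d y) - F (clamp c d x)) by ring.
  rewrite VE// subr_ge0 (le_trans (ler_norm _))// -lee_fin fineK ?fV ?hh//.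
  by apply: total_variation_ge; exact: hh.
- apply: acD => //; apply: acN.
  move=> e e0; have [r r0 rF] := acF e e0; exists r => // l nl lr.
  have cl := contraction_clamp cd.
  have := rF _ (contraction_nonoverlapping cl nl)
    (le_lt_trans (contraction_total_length cl nl) lr).
  by rewrite /total_increment big_map.
Qed.

(** The parts of the intervals of [l] on the left of [a] and on the right of
    [b]; an empty part becomes a degenerate interval at [a] or [b]. *)
Definition cut a b l :=
  [seq (Num.min p.1 a, Num.min p.2 a) | p <- l] ++
  [seq (Num.max p.1 b, Num.max p.2 b) | p <- l].

Lemma nonoverlapping_cut a b l : a <= b -> nonoverlapping l ->
  [/\ nonoverlapping ((a, b) :: cut a b l),
      total_length (cut a b l) <= total_length l &
      forall x, has (fun p => p.1 < x <= p.2) l -> 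
       has (fun p => p.1 < x <= p.2) ((a, b) :: cut a b l)].
Proof.
move=> ab nl; have [/allP ll _] := andP nl.
have [hm Hm] : monotone_contraction (Num.min^~ a).
  split => x y xy; rewrite !minEle;
  case: (lerP x a) => ?; case: (lerP y a) => ?; lra.
have [hM HM] : monotone_contraction (Num.max^~ b).
  split => x y xy; rewrite !maxEle;
  case: (lerP x b) => ?; case: (lerP y b) => ?; lra.
split.
- rewrite -cat1s /cut !nonoverlapping_cat.
  rewrite (contraction_nonoverlapping (conj hm Hm) nl).
  rewrite (contraction_nonoverlapping (conj hM HM) nl).
  rewrite {1}/nonoverlapping/= ab/= allrel1l all_cat.
  apply/and3P; split.
  + by apply/allrelP => p q /mapP[p' _ ->] /mapP[q' _ ->];
      rewrite /sep/= (le_trans _ (le_trans ab _))// ?ge_min ?le_max lexx ?orbT.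
  + by apply/allP => p /mapP[p' _ ->]; rewrite /sep/= ge_min lexx !orbT.
  + by apply/allP => p /mapP[p' _ ->]; rewrite /sep/= le_max lexx !orbT.
- rewrite total_length_cat /total_length !big_map -big_split/= big_seq.
  rewrite [leRHS]big_seq; apply: ler_sum => p /ll pp.
  rewrite !minEle !maxEle.
  by case: (lerP p.1 a) => ?; case: (lerP p.2 a) => ?;
     case: (lerP p.1 b) => ?; case: (lerP p.2 b) => ?; lra.
- move=> x /hasP[p pl /andP[px xp]]; have [xa|ax] := leP x a.
    apply/hasP; exists (Num.min p.1 a, Num.min p.2 a).
      rewrite inE mem_cat; apply/orP; right; apply/orP; left.
      exact: (map_f (fun p => (Num.min p.1 a, Num.min p.2 a))).
    by rewrite /= gt_min px/= le_min xp xa.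
  have [xb|bx] := leP x b.
    by apply/hasP; exists (a, b); rewrite ?mem_head//= ax.
  apply/hasP; exists (Num.max p.1 b, Num.max p.2 b).
    rewrite inE mem_cat; apply/orP; right; apply/orP; right.
    exact: (map_f (fun p => (Num.max p.1 b, Num.max p.2 b))).
  by rewrite /= gt_max px bx/= le_max xp.
Qed.

(** The intervals of a cover by finitely many half-open intervals may overlap.
    They are added one by one, each after the others have been cut along it. *)
Lemma nonoverlapping_refine l : all (fun p => p.1 <= p.2) l -> exists l',
  [/\ nonoverlapping l', total_length l' <= total_length l &
      forall x, has (fun p => p.1 < x <= p.2) l ->
        has (fun p => p.1 < x <= p.2) l'].
Proof.
elim: l => [_|[a b] l ih /= /andP[ab /ih[l' [nl' ll' cov]]]].
  by exists [::]; rewrite /nonoverlapping.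
have [nc lc cc] := nonoverlapping_cut ab nl'.
exists ((a, b) :: cut a b l'); split => //.
  by rewrite /total_length !big_cons lerD// (le_trans lc).
move=> x /orP[xab|/cov/cc//].
by rewrite /= xab.
Qed.

End jordan.

(** * Densities of absolutely continuous functions *)

Section density.
Set Implicit Arguments.
Unset Strict Implicit.
Context {R : realType}.
Local Notation mu := (@lebesgue_measure R).
Implicit Types (p q : R * R) (l : seq (R * R)) (F G : R -> R).

Lemma ac_right_continuous G : ac G -> right_continuous G.
Proof.
move=> acG x; apply/cvgrPdist_lt => e e0.
have [d d0 de] := acG e e0.
near=> y; have xy : x < y by near: y; exact: nbhs_right_gt.
rewrite distrC; have := de [:: (x, y)].
rewrite /total_length /total_increment !big_seq1/= /nonoverlapping/= (ltW xy).
apply=> //; rewrite ltrBlDl; near: y; apply: nbhs_right_lt.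
by rewrite ltrDl.
Unshelve. all: by end_near. Qed.

Definition oc_cover l : set (measurableTypeR R) :=
  [set x | has (fun p => p.1 < x <= p.2) l].

Lemma oc_cover_cons p l : oc_cover (p :: l) = `]p.1, p.2] `|` oc_cover l.
Proof.
by apply/seteqP; split => x /=; rewrite /oc_cover/= in_itv/= => /orP.
Qed.

Lemma measurable_oc_cover l : measurable (oc_cover l).
Proof.
elim: l => [|p l ih]; last first.
  by rewrite oc_cover_cons; apply: measurableU => //; exact: measurable_itv.
by rewrite (_ : oc_cover _ = set0)//; apply/seteqP; split.
Qed.

Lemma lebesgue_stieltjes_oc (G : cumulative R R) (u v : R) : u <= v ->
  lebesgue_stieltjes_measure G `]u, v]%classic = (G v - G u)%:E.
Proof.
move=> uv; rewrite /lebesgue_stieltjes_measure /measure_extension.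
by rewrite measurable_mu_extE/= ?wlength_itv_bnd//; exact: is_ocitv.
Qed.

Lemma le_lebesgue_stieltjes_oc_cover (G : cumulative R R) l :
  all (fun p => p.1 <= p.2) l ->
  (lebesgue_stieltjes_measure G (oc_cover l) <= (total_increment G l)%:E)%E.
Proof.
elim: l => [_|p l ih /= /andP[pp /ih {}ih]].
  rewrite (_ : oc_cover _ = set0) ?measure0 ?lee_fin ?sumr_ge0//.
  by apply/seteqP; split.
rewrite oc_cover_cons; apply: (le_trans (measureU2 _ _ _)).
- exact: measurable_itv.
- exact: measurable_oc_cover.
rewrite /total_increment big_cons EFinD leeD//=.
by rewrite lebesgue_stieltjes_oc// lee_fin ler_norm.
Qed.

(** A Lebesgue null set is covered by countably many intervals of small total
    length; finitely many of them can be made disjoint, where absolute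
    continuity applies. *)
Lemma ac_lebesgue_stieltjes_dominated (G : cumulative R R) : ac G ->
  lebesgue_stieltjes_measure G `<< mu.
Proof.
move=> acG; apply/null_content_dominatesP => A mA A0.
apply/eqP; rewrite eq_le measure_ge0 andbT; apply/lee_addgt0Pr => e e0.
rewrite add0e.
have [d d0 de] := acG e e0.
have : (mu A < d%:E)%E by rewrite A0 lte_fin.
move=> /ereal_inf_lt[_ [/= F [mF AF] <-] Fd].
have /choice[w wF] : forall k, exists p : R * R,
    p.1 <= p.2 /\ F k = `]p.1, p.2]%classic.
  move=> k; have /ocitvP[->|[[a b] /= ab ->]] : ocitv (F k) by exact: mF.
    by exists (0, 0); rewrite /= set_itvoc0.
  by exists (a, b) => //=; split => //; exact: ltW.
pose L n := [seq w k | k <- iota 0 n].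
have LE n x : oc_cover (L n) x <-> exists2 k, (k < n)%N & F k x.
  split=> [/hasP[p /mapP[k]]|[k kn Fkx]].
    rewrite mem_iota add0n/= => kn -> h; exists k => //.
    by have [_ ->] := wF k; rewrite /= in_itv.
  apply/hasP; exists (w k); first by apply: map_f; rewrite mem_iota.
  by have [_ Fk] := wF k; move: Fkx; rewrite Fk /= in_itv.
have Ld n : total_length (L n) < d.
  rewrite -lte_fin; apply: le_lt_trans Fd.
  rewrite /total_length big_map -sumEFin.
  rewrite (eq_bigr (fun k => wlength idfun (F k))); last first.
    by move=> k _; have [wk ->] := wF k; rewrite wlength_itv_bnd.
  rewrite -{1}[n]subn0; apply: nneseries_lim_ge => k _ _.
  by have [wk ->] := wF k; rewrite wlength_itv_bnd// lee_fin subr_ge0.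
have Le n : (lebesgue_stieltjes_measure G (oc_cover (L n)) <= e%:E)%E.
  have /nonoverlapping_refine[l [nl ll cov]] : all (fun p => p.1 <= p.2) (L n).
    by apply/allP => p /mapP[k _ ->]; have [] := wF k.
  have [wl _] := andP nl.
  rewrite (@le_trans _ _ (lebesgue_stieltjes_measure G (oc_cover l)))//.
    by apply: le_measure; rewrite ?inE//; exact: measurable_oc_cover.
  rewrite (le_trans (le_lebesgue_stieltjes_oc_cover G wl))// lee_fin ltW//.
  by apply: de => //; rewrite (le_lt_trans ll).
have mB n : measurable (oc_cover (L n)) by exact: measurable_oc_cover.
pose U := \bigcup_n oc_cover (L n).
rewrite (@le_trans _ _ (lebesgue_stieltjes_measure G U))//.
  apply: le_measure; rewrite ?inE//; first exact: bigcupT_measurable.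
  move=> x /AF[k _ Fkx]; exists k.+1 => //; apply/LE; by exists k.
have cB := @nondecreasing_cvg_mu _ _ _ (lebesgue_stieltjes_measure G) _ mB
  (bigcupT_measurable _ mB).
rewrite -(cvg_lim _ (cB _))//; last first.
  move=> m n mn; apply/subsetPset => x /LE[k km Fkx].
  by apply/LE; exists k => //; exact: leq_trans mn.
apply: lime_le; last exact: nearW.
apply/cvg_ex; eexists; apply: cB => m n mn; apply/subsetPset => x /LE[k km Fkx].
by apply/LE; exists k => //; exact: leq_trans mn.
Qed.

Lemma nondecreasing_ac_density G (T : R) : 0 <= T ->
  {homo G : x y / x <= y} -> ac G ->
  exists g : R -> R, mu.-integrable [set: R] (EFin \o g) /\
    forall x, 0 <= x <= T -> G x - G 0 = \int[mu]_(t in `]0, x]) g t.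
Proof.
move=> T0 ndG acG.
pose cG : cumulative R R :=
  HB.pack G (isCumulative.Build R _ R G ndG (ac_right_continuous acG)).
pose nu := lebesgue_stieltjes_measure cG.
have mD : measurable (`]0, T]%classic : set (measurableTypeR R)).
  exact: measurable_itv.
have Dlty : (nu `]0%R, T]%classic < +oo)%E.
  by rewrite /nu lebesgue_stieltjes_oc// ltry.
have nu_mu : nu `<< mu by exact: (@ac_lebesgue_stieltjes_dominated cG acG).
have nuD_mu : mfrestr mD Dlty `<< mu.
  apply/null_content_dominatesP => A mA A0.
  move/null_content_dominatesP in nu_mu.
  apply/eqP; rewrite eq_le measure_ge0 andbT -(nu_mu A mA A0).
  by apply: le_measure; rewrite ?inE//; exact: measurableI.
have [f [f0 ffin intf fE]] := radon_nikodym_sigma_finite nuD_mu.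
exists (fine \o f).
have fineE : EFin \o (fine \o f) = f.
  by apply/funext => x /=; rewrite fineK.
split; first by rewrite fineE.
move=> x /andP[x0 xT]; rewrite /Rintegral.
rewrite (_ : (\int[mu]_(t in _) _)%E =
    \int[mu]_(t in `]0%R, x]) f t)%E; last first.
  by apply: eq_integral => t _; rewrite -[in RHS]fineE.
rewrite -fE; last exact: measurable_itv.
rewrite /= /mfrestr /mrestr/= setIidl; last first.
  by apply: subset_itvl; rewrite bnd_simp.
by rewrite lebesgue_stieltjes_oc.
Qed.

(** The fundamental theorem of calculus for absolutely continuous functions:
    both parts of the Jordan decomposition have a Radon-Nikodym density. *)
Lemma abs_continuous_density F (T : R) : 0 <= T -> abs_continuous 0 T F ->
  exists g : R -> R, mu.-integrable [set: R] (EFin \o g) /\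
    forall x, 0 <= x <= T -> F x - F 0 = \int[mu]_(t in `]0, x[) g t.
Proof.
move=> T0 /(abs_continuous_ac T0) acF.
have [V [ndV acV ndW acW]] := ac_jordan T0 acF.
have [v [iv vE]] := nondecreasing_ac_density T0 ndV acV.
have [w [iw wE]] := nondecreasing_ac_density T0 ndW acW.
exists (v \- w); split.
  exact: integrableB iv iw.
move=> x x0T; have x0 : 0 <= x by case/andP : x0T.
have ivx : mu.-integrable `]0, x] (EFin \o v) by exact: integrableS iv.
have iwx : mu.-integrable `]0, x] (EFin \o w) by exact: integrableS iw.
rewrite Rintegral_itv_bndo_bndc; last first.
  have := integrableB measurableT iv iw.
  by move=> ivw; exact: integrableS ivw.
rewrite RintegralB// -vE// -wE//=.
by rewrite !(clamp_id x0T) !clamp_id ?lexx//; ring.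
Qed.

End density.

(** * Weighted Morrey spaces *)

Section morrey.
Set Implicit Arguments.
Unset Strict Implicit.
Context {R : realType}.
Local Notation mu := (@lebesgue_measure R).
Implicit Types (T lambda : R) (omega g phi : R -> R).

Lemma ae_exists_itv (P : R -> Prop) (c d : R) : c < d ->
  {ae mu, forall x, P x} -> exists2 x, c < x < d & P x.
Proof.
move=> cd [N [mN N0 sN]]; apply: contrapT => nP.
have : (mu `]c, d[%classic <= mu N)%E.
  apply: le_measure; rewrite ?inE//.
  move=> x /=; rewrite in_itv/= => xcd.
  by apply: (sN x) => /= Px; apply: nP; exists x.
rewrite N0 lebesgue_measure_itv/= lte_fin cd -EFinD lee_fin subr_le0.
by rewrite leNgt cd.
Qed.

(** At almost every point the maximal function of [omega] is finite; a point
    [x] to the right of [d] bounds the average of [omega] over [[c, x]]. *)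
Lemma A1plus_locally_finite omega (c d : R) : weight omega -> A1plus omega ->
  (\int[mu]_(x in `[c, d]) (omega x)%:E < +oo)%E.
Proof.
move=> [om0 _] [C].
have [dc|cd] := ltP d c.
  by rewrite set_itv_ge ?integral_set0 ?bnd_simp -?ltNge.
move=> /(@ae_exists_itv _ d (d + 1))[|x /andP[dx _] Mx]; first by rewrite ltrDl.
have cx : 0 < x - c by rewrite subr_gt0 (le_lt_trans cd).
have : ((x - c)^-1%:E * \int[mu]_(y in `[c, x]) `|(omega y)%:E| < +oo)%E.
  apply: (le_lt_trans _ (ltry (C * omega x))); apply: le_trans Mx.
  apply: ereal_sup_ubound; exists (x - c) => //.
  by rewrite subKr.
rewrite lte_pdivrMl// => h.
have {}h : (\int[mu]_(y in `[c, x]) `|(omega y)%:E| < +oo)%E.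
  by move: h; rewrite gt0_muley.
apply: le_lt_trans h; rewrite integral_mkcond [leRHS]integral_mkcond.
apply: ge0_ae_le_integral => //.
- by move=> y _; rewrite patchE; case: ifP => // _; rewrite lee_fin ltW.
- by move=> y _; rewrite patchE; case: ifP => // _.
apply: aeW => y _; rewrite !patchE; case: ifPn => [|_]; last first.
  by case: ifP => // _; rewrite abse_ge0.
rewrite inE/= in_itv/= => /andP[cy yd]; rewrite mem_set/=.
  by rewrite lee_fin ler_norm.
by rewrite in_itv/= cy (le_trans yd (ltW dx)).
Qed.

(** The quotient for [x0 = 0] and [h = T] involves the integral of [g] over the
    whole of (0, T). *)
Lemma in_morrey_integrable T lambda omega g : 0 < T ->
  weight omega -> A1plus omega ->
  in_morrey T lambda omega g -> lebesgue_integrable `]0, T[ g.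
Proof.
move=> T0 wom A1 [mg gT]; split=> //.
have om0 : (0 <= \int[mu]_(x in `[(0 - T)%R, 0%R]) (omega x)%:E)%E.
  by apply: integral_ge0 => x _; rewrite lee_fin ltW//; case: wom.
have omoo := A1plus_locally_finite (0 - T) 0 wom A1.
pose A := ((T `^ (lambda - 1))%R%:E *
  \int[mu]_(x in `[(0 - T)%R, 0%R]) (omega x)%:E)%E.
pose I := (\int[mu]_(x in `]0%R, T[) `|(g x)%:E|)%E.
have vA : (A^-1 * I < +oo)%E.
  apply: le_lt_trans gT; apply: ereal_sup_ubound; exists 0, T; split.
  - by rewrite lexx ltW.
  - by rewrite T0 lexx.
  - by rewrite (add0r T) setIid.
have A0 : (0 <= A)%E by rewrite mule_ge0// lee_fin powR_ge0.
have Aoo : (A < +oo)%E by rewrite lte_mul_pinfty// lee_fin powR_ge0.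
(* The inverse of 0 is +oo, so finiteness of A suffices. *)
have Ai : (0 < A^-1)%E.
  move: A0 Aoo; clear; case: A => [r||]//.
  rewrite lee_fin le_eqVlt inver eq_sym.
  by case: eqP => //= _ r0 _; rewrite lte_fin invr_gt0.
rewrite ltNge leye_eq; apply/negP => /eqP Ioo.
by move: vA; rewrite /I Ioo gt0_muley.
Qed.

Lemma in_morrey_congr T lambda omega g1 g2 :
  {ae mu, forall x, 0 < x < T -> g1 x = g2 x} ->
  in_morrey T lambda omega g1 -> in_morrey T lambda omega g2.
Proof.
move=> g12 [mg1 ng1]; split.
  apply: lebesgue_measurable_congr mg1; apply: filterS g12 => x + /=.
  by rewrite in_itv.
rewrite (_ : morrey_norm T lambda omega g2 = morrey_norm T lambda omega g1)//.
rewrite /morrey_norm; congr ereal_sup.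
apply/seteqP; split => _ [x0 [h [x0T hT ->]]]; exists x0, h; split => //;
  congr (_ * _)%E; apply: ae_congr_integral; apply: filterS g12 => x + [_ /=];
  by rewrite in_itv/= => /[apply] ->.
Qed.

End morrey.

(** * Abel's equation *)

Section abel_equation.
Set Implicit Arguments.
Unset Strict Implicit.
Context {R : realType}.
Local Notation mu := (@lebesgue_measure R).
Variables (T a : R) (T0 : 0 < T) (a01 : 0 < a < 1).
Implicit Types (lambda : R) (omega f g phi : R -> R).

Let b01 : 0 < 1 - a < 1.
Proof. by case/andP: a01 => ? ?; rewrite subr_gt0 gtrBl; apply/andP. Qed.

(** The fractional integral of [phi] converges at some [x] between [c] and
    [T]. *)
Lemma abel_solution_integrable f phi c : abel_solution T a f phi -> c < T ->
  lebesgue_integrable `]0, c[ phi.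
Proof.
move=> sol cT; have mcT : Num.max 0 c < T by rewrite gt_max T0.
have [x /andP[cx xT]] := ae_exists_itv mcT sol.
move: cx; rewrite gt_max => /andP[x0 cx] /(_ _)[]; first by rewrite x0.
move=> /(RL_defined_integrable a01) + _; apply: lebesgue_integrableS.
- exact: measurable_itv.
- exact: measurable_itv.
- by apply: subset_itvl; rewrite bnd_simp ltW.
Qed.

Lemma abel_solution_RL f phi x : abel_solution T a f phi -> 0 < x < T ->
  RL_defined (1 - a) f x /\
  RL_integral (1 - a) f x = \int[mu]_(t in `]0, x[) phi t.
Proof.
move=> sol /andP[x0 xT]; apply: abel_inversion a01 (subrKC _ _) _ _.
  exact: abel_solution_integrable sol xT.
apply: filterS sol => t + /andP[t0 tx]; rewrite t0 (lt_trans tx xT) => /(_ isT).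
by case.
Qed.

(** Since [phi] is determined by [f] almost everywhere, this is the uniqueness
    of the solution. *)
Lemma abel_solution_derive f phi : abel_solution T a f phi ->
  {ae mu, forall x, 0 < x < T ->
    derivable (RL_integral (1 - a) f) x 1 /\ RL_derivative a f x = phi x}.
Proof.
move=> sol; apply: ae_interval_exhaust => // d /andP[d0 dT].
apply: ae_derive_integral; first exact: abel_solution_integrable sol dT.
by move=> x /andP[x0 xd]; apply: (abel_solution_RL sol _).2;
  rewrite x0 (lt_trans xd).
Qed.

Lemma abel_solution_in_morrey lambda omega f phi : abel_solution T a f phi ->
  in_morrey T lambda omega phi -> in_morrey T lambda omega (RL_derivative a f).
Proof.
move=> /abel_solution_derive sol; apply: in_morrey_congr.
by apply: filterS sol => x /[apply] -[].
Qed.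

Lemma abel_solvable_condition lambda omega f : weight omega -> A1plus omega ->
  abel_solvable_morrey T lambda omega a f -> abel_condition T lambda omega a f.
Proof.
move=> wom A1 [phi [mphi sol]]; split; last first.
  exact: abel_solution_in_morrey sol mphi.
have := in_morrey_integrable T0 wom A1 mphi.
move=> /lebesgue_integrable_repr[]// p [mp ip phip p0].
have p0' s : s <= 0 -> p s = 0.
  by move=> s0; apply: p0; rewrite /= in_itv/= ltNge s0.
exists (fun x => \int[mu]_(t in `]-oo, x]) p t); split.
- move=> x xT; have [dx ->] := abel_solution_RL sol xT; split => //.
  rewrite -integral_line//; apply: ae_congr_Rintegral.
  apply: filterS phip => t phit; rewrite /= in_itv/= => /andP[t0 tx].
  rewrite phit//= in_itv/= t0 (lt_trans tx)//; by case/andP: xT.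
- exact: integral_abs_continuous.
- by rewrite -integral_line// set_itv_ge ?Rintegral_set0 ?bnd_simp ?ltxx.
Qed.

(** If [I^(1 - a) f] is the integral of [g], then so is [I^(1 - a) (I^a g)];
    by the inversion formula with [1 - a] in the place of [a], [f] and [I^a g]
    have the same indefinite integral. *)
Lemma abel_condition_ae_eq f g : lebesgue_integrable `]0, T[ g ->
  (forall x, 0 < x < T -> RL_defined (1 - a) f x /\
    RL_integral (1 - a) f x = \int[mu]_(t in `]0, x[) g t) ->
  {ae mu, forall x, 0 < x < T -> RL_integral a g x = f x}.
Proof.
move=> ig fg; pose f1 := RL_integral a g.
have igx x : 0 < x < T -> lebesgue_integrable `]0, x[ g.
  move=> /andP[x0 xT]; apply: lebesgue_integrableS ig => //.
  by apply: subset_itvl; rewrite bnd_simp ltW.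
have f1g x : 0 < x < T -> RL_defined (1 - a) f1 x /\
    RL_integral (1 - a) f1 x = \int[mu]_(t in `]0, x[) g t.
  move=> xT; apply: abel_inversion a01 (subrKC _ _) (igx _ xT) _.
  exact: aeW.
have if_ x : 0 < x < T -> lebesgue_integrable `]0, x[ f.
  by move=> /fg[+ _]; exact: RL_defined_integrable.
have if1 x : 0 < x < T -> lebesgue_integrable `]0, x[ f1.
  by move=> /f1g[+ _]; exact: RL_defined_integrable.
have ff1 x : 0 < x < T ->
    \int[mu]_(t in `]0, x[) f t = \int[mu]_(t in `]0, x[) f1 t.
  move=> xT; pose F := RL_integral (1 - a) f.
  have Ff : {ae mu, forall t, 0 < t < x -> F t = RL_integral (1 - a) f t}.
    exact: aeW.
  have Ff1 : {ae mu, forall t, 0 < t < x -> F t = RL_integral (1 - a) f1 t}.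
    apply: aeW => t /andP[t0 tx]; have tT : 0 < t < T.
      by rewrite t0 (lt_trans tx)//; case/andP: xT.
    by rewrite /F (fg _ tT).2 (f1g _ tT).2.
  have [_ <-] := abel_inversion b01 (subrK _ _) (if_ _ xT) Ff.
  by have [_ <-] := abel_inversion b01 (subrK _ _) (if1 _ xT) Ff1.
apply: ae_interval_exhaust => // d dT.
have sub x : 0 < x < d -> 0 < x < T.
  by move=> /andP[-> xd]; rewrite (lt_trans xd)//; case/andP: dT.
pose P x := \int[mu]_(t in `]0, x[) f t.
have Pf : {ae mu, forall x, 0 < x < d -> derivable P x 1 /\ derive1 P x = f x}.
  by apply: ae_derive_integral (if_ _ dT) _.
have Pf1 : {ae mu, forall x, 0 < x < d ->
    derivable P x 1 /\ derive1 P x = f1 x}.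
  by apply: ae_derive_integral (if1 _ dT) _ => x /sub xT; exact: ff1.
apply: filterS2 Pf Pf1 => x + + xd => /(_ xd)[_ fx] /(_ xd)[_ f1x].
by rewrite -fx f1x.
Qed.

Lemma abel_condition_solution lambda omega f :
  abel_condition T lambda omega a f -> abel_solution T a f (RL_derivative a f).
Proof.
move=> [[F [FE acF F0]] _].
have [g [ig gE]] := abs_continuous_density (ltW T0) acF.
have ig' : lebesgue_integrable `]0, T[ g.
  apply: (@repr_lebesgue_integrable _ _ _ g) => //; first exact: integrableS ig.
  exact: aeW.
have fg x : 0 < x < T -> RL_defined (1 - a) f x /\
    RL_integral (1 - a) f x = \int[mu]_(t in `]0, x[) g t.
  move=> xT; have [dx <-] := FE x xT; split => //.
  by rewrite -gE ?F0 ?subr0//; case/andP: xT => ? ?; rewrite !ltW.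
have solg : abel_solution T a f g.
  have := abel_condition_ae_eq ig' fg; have := ae_RL_defined a01 ig'.
  by apply: filterS2 => x + + xT => /(_ xT) ? /(_ xT).
have gD : {ae mu, forall x, 0 < x < T -> g x = RL_derivative a f x}.
  have := abel_solution_derive solg.
  by apply: filterS => x /[apply] -[].
apply: filterS solg => x + xT => /(_ xT)[dx <-]; have /andP[x0 /ltW xT'] := xT.
split; first exact: RL_defined_congr xT' gD dx.
apply/esym; exact: RL_integral_congr xT' gD.
Qed.

End abel_equation.

Theorem theorem4p3 (R : realType) (T alpha lambda : R) (omega f : R -> R)
    (hT : 0 < T) (halpha : 0 < alpha < 1) (hlambda : 0 < lambda < 1)
    (homega : weight omega) (hA1 : A1plus omega) :
  (abel_solvable_morrey T lambda omega alpha f <->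
   abel_condition T lambda omega alpha f) /\
  (abel_condition T lambda omega alpha f ->
   [/\ in_morrey T lambda omega (RL_derivative alpha f),
       abel_solution T alpha f (RL_derivative alpha f) &
       forall phi : R -> R, abel_solution T alpha f phi ->
         {ae (@lebesgue_measure R), forall x, 0 < x < T ->
           derivable (RL_integral (1 - alpha) f) x 1 /\
           phi x = RL_derivative alpha f x}]).
Proof.
split; first split.
- exact: abel_solvable_condition.
- move=> cond; exists (RL_derivative alpha f); split; first by case: cond.
  exact: abel_condition_solution cond.
- move=> cond; split; first by case: cond.
    exact: abel_condition_solution cond.
  move=> phi /(abel_solution_derive hT halpha).
  by apply: filterS => x /[apply] -[].
Qed.
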